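(* Assume that the over-determined nonlinear elliptic problem $$\begin{cases} c(\mathbf{x})\sum_{n=1}^N s_{mn}u_n(\mathbf{x})=\Delta u_m(\mathbf{x})+q_m(u_1(\mathbf{x}),\dots,u_N(\mathbf{x})), & \mathbf{x}\in\Omega,\\ u_m(\mathbf{x})=f_m(\mathbf{x}),\quad \partial_\nu u_m(\mathbf{x})=g_m(\mathbf{x}), & \mathbf{x}\in\partial\Omega,\end{cases}\qquad m=1,\dots,N,$$ has a unique solution $(u_m^* )_{m=1}^N\in H$. Put $u^*(\mathbf{x},t)=\sum_{n=1}^N u_n^*(\mathbf{x})\Psi_n(t)$ and suppose that $M>\|u^*\|_{L^\infty(\Omega\times[0,T])}$. Then there are a constant $\lambda_0$, depending only on $\Omega,T,d,N$, and a constant $C>0$, depending only on $\Omega$, $T$, $M$, $d$, $N$ and the $C^1$ norm of $q$ (but not on $\lambda$ or $k$), such that for every $\lambda\ge\lambda_0$ the sequence of minimizers $(u_m^{(k)})_{m=1}^N$ satisfies $$\sum_{m=1}^N\Big\|e^{\lambda b^{-\beta}r^\beta(\mathbf{x})}(u_m^{(k)}-u_m^* )\Big\|_{L^2(\Omega)}^2\le\Big[\frac{C}{\lambda^3}\Big]^{k-1}\sum_{m=1}^N\Big\|e^{\lambda b^{-\beta}r^\beta(\mathbf{x})}(u_m^{(1)}-u_m^* )\Big\|_{L^2(\Omega)}^2,\qquad k=1,2,\dots$$ In particular, if $\lambda$ is large enough that $0<C/\lambda^3<1$, then $u_m^{(k)}\to u_m^*$ exponentially in $L^2(\Omega)$ as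 $k\to\infty$ for each $m=1,\dots,N$. Moreover, for such $\lambda$, the functions $p^{(k)}(\mathbf{x})=\sum_{n=1}^N u_n^{(k)}(\mathbf{x})\Psi_n(0)$ converge in $L^2(\Omega)$, as $k\to\infty$, to $p^*(\mathbf{x})=u^*(\mathbf{x},0)=\sum_{n=1}^N u_n^*(\mathbf{x})\Psi_n(0)$.
   Context: Fixed data: $d\ge1$, $T>0$, $N\ge1$; $\Omega\subset\mathbb{R}^d$ is a bounded open domain with smooth boundary and outward normal $\nu$; $q:\mathbb{R}\to\mathbb{R}$ and $c:\mathbb{R}^d\to\mathbb{R}$ are of class $C^1$, with $c\ge c_0$ for some $c_0>0$; $\{\Psi_n\}_{n\ge1}$ is an orthonormal basis of $L^2(0,T)$ with $\Psi_n\in C^1([0,T])$; $f_m,g_m\in L^2(\partial\Omega)$, $1\le m\le N$. Notation: $s_{mn}=\int_0^T\Psi_n'(t)\Psi_m(t)\,dt$ and $$q_m(s_1,\dots,s_N)=\int_0^T q\Big(\sum_{n=1}^N s_n\Psi_n(t)\Big)\Psi_m(t)\,dt .$$ The $C^1$ norm of $q$ is taken over the bounded interval $\{|s|\le M\sqrt T\max_{t\in[0,T]}\sum_{n=1}^N|\Psi_n(t)|\}$. Admissible set: $H=\{(u_m)_{m=1}^N\in H^2(\Omega)^N:\ u_m|_{\partial\Omega}=f_m,\ \partial_\nu u_m|_{\partial\Omega}=g_m,\ 1\le m\le N\}$ (boundary values in the sense of traces). Cut-off: $M>0$ is a fixed constant and $P(s)=\max\{-M\sqrt T,\min\{s,M\sqrt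 T\}\}$ for $s\in\mathbb{R}$. Weight: $\mathbf{x}_0\in\mathbb{R}^d\setminus\Omega$ and $r(\mathbf{x})=|\mathbf{x}-\mathbf{x}_0|$ with $\min_{\overline\Omega}r>1$; $b>\max_{\overline\Omega}r$ is fixed; $\beta>0$ is a fixed number (depending only on $b,\mathbf{x}_0,\Omega,d$) for which there are constants $C',\lambda'>0$ such that for all $\lambda\ge\lambda'$ and all $v\in H^2(\Omega)$ with $v=\partial_\nu v=0$ on $\partial\Omega$, $$\int_\Omega e^{2\lambda b^{-\beta}r^\beta}|\Delta v|^2\,d\mathbf{x}\ge C'\int_\Omega e^{2\lambda b^{-\beta}r^\beta}\Big[\lambda^{-1}\sum_{i,j=1}^d|\partial^2_{x_ix_j}v|^2+\lambda|\nabla v|^2+\lambda^3|v|^2\Big]d\mathbf{x}.$$ Iteration: $(u_m^{(0)})_{m=1}^N$ is the minimizer over $H$ of $$J^{(0)}(u_1,\dots,u_N)=\sum_{m=1}^N\int_\Omega e^{2\lambda b^{-\beta}r^\beta(\mathbf{x})}\Big|\Delta u_m-c(\mathbf{x})\sum_{n=1}^N s_{mn}u_n\Big|^2d\mathbf{x},$$ and for $k\ge1$, $(u_m^{(k)})_{m=1}^N$ is the minimizer over $H$ of $$J^{(k)}(u_1,\dots,u_N)=\sum_{m=1}^N\int_\Omega e^{2\lambda b^{-\beta}r^\beta(\mathbf{x})}\Big|\Delta u_m-c(\mathbf{x})\sum_{n=1}^N s_{mn}u_n+q_m\big(P(u_1^{(k-1)}),\dots,P(u_N^{(k-1)})\big)\Big|^2d\mathbf{x}.$$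 These minimizers exist and are unique for $\lambda$ sufficiently large. The objects $\mathbf{x}_0,b,\beta,c,\{\Psi_n\}$ are fixed throughout, and dependence of constants on them is not displayed. *)

(* Defs.v *)
From HB Require Import structures.
From mathcomp Require Import all_boot all_order all_algebra.
From mathcomp Require Import all_classical all_reals all_analysis.
Set Implicit Arguments.
Unset Strict Implicit.
Unset Printing Implicit Defensive.
Import Order.TTheory GRing.Theory Num.Theory.
Import numFieldNormedType.Exports.
Local Open Scope classical_set_scope.
Local Open Scope ring_scope.

Definition rV_display : measure_display.
Proof. exact: default_measure_display. Qed.

(** Row vectors carry the product sigma-algebra, generated by the coordinates;
    on R^n this is the Borel sigma-algebra. *)
Section rV_measurable.
Context (R : realType) (n : nat).

Let coors : 'I_n -> 'rV[R]_n -> R := fun i x => x ord0 i.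

Let rV_set0 : g_sigma_preimage coors set0.
Proof. exact: sigma_algebra0. Qed.

Let rV_setC A : g_sigma_preimage coors A -> g_sigma_preimage coors (~` A).
Proof. exact: sigma_algebraC. Qed.

Let rV_bigcup (F : (set 'rV[R]_n)^nat) :
  (forall i, g_sigma_preimage coors (F i)) ->
  g_sigma_preimage coors (\bigcup_i (F i)).
Proof. exact: sigma_algebra_bigcup. Qed.

HB.instance Definition _ := @isMeasurable.Build rV_display
  'rV[R]_n (g_sigma_preimage coors) rV_set0 rV_setC rV_bigcup.

End rV_measurable.

Lemma measurable_coord (R : realType) n (i : 'I_n) :
  measurable_fun [set: 'rV[R]_n] (fun x : 'rV[R]_n => x ord0 i).
Proof.
move=> _ Y mY; rewrite setTI; apply: sub_sigma_algebra => /=.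
rewrite -bigcup_seq/=; exists i => /=; first by rewrite mem_index_enum.
by exists Y => //; rewrite setTI.
Qed.

Lemma measurable_fun_coordP (R : realType) d (T : measurableType d) n
    (f : T -> 'rV[R]_n) :
  (forall i, measurable_fun [set: T] (fun x => f x ord0 i)) ->
  measurable_fun [set: T] f.
Proof.
move=> mf _ A mA; rewrite setTI.
suff : g_sigma_preimage (fun (i : 'I_n) (x : 'rV[R]_n) => x ord0 i) `<=`
    [set B | measurable (f @^-1` B)] by exact.
apply: smallest_sub.
  split => /=.
  - by rewrite preimage_set0.
  - by move=> B mB; rewrite setTD preimage_setC; exact: measurableC.
  - by move=> F mF; rewrite preimage_bigcup; exact: bigcup_measurable.
rewrite -bigcup_seq/=; apply: bigcup_sub => i _ B [C mC <-] /=.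
by rewrite setTI; have := mf i measurableT C mC; rewrite setTI.
Qed.

Section Lebesgue_rV.
Context (R : realType).

Definition rVcons n (p : R * 'rV[R]_n) : 'rV[R]_n.+1 := row_mx p.1%:M p.2.

Lemma measurable_rVcons n : measurable_fun setT (@rVcons n).
Proof.
apply: measurable_fun_coordP; rewrite -[n.+1]/(1 + n)%N => i.
case: (split_ordP i) => j ->.
  rewrite (_ : (fun _ => _) = fst); first exact: measurable_fst.
  by apply/funext => x; rewrite (row_mxEl (x.1%:M) x.2) (ord1 j) mxE eqxx mulr1n.
rewrite (_ : (fun _ => _) = (fun y : 'rV[R]_n => y ord0 j) \o snd); last first.
  by apply/funext => x; rewrite (row_mxEr (x.1%:M) x.2).
apply: measurableT_comp; [exact: measurable_coord|exact: measurable_snd].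
Qed.

Let split0 n (x : 'rV[R]_n.+1) : R * 'rV[R]_n :=
  (x ord0 ord0, \row_j x ord0 (rshift 1 j)).

Let measurable_split0 n : measurable_fun setT (@split0 n).
Proof.
apply/measurable_fun_pairP; split; first exact: measurable_coord.
apply: measurable_fun_coordP => i.
rewrite (_ : (fun _ => _) = (fun x : 'rV[R]_n.+1 => x ord0 (rshift 1 i))).
  exact: (@measurable_coord R n.+1 (rshift 1 i)).
by apply/funext => x; rewrite /= mxE.
Qed.

Let split0K n : cancel (@rVcons n) (@split0 n).
Proof.
move=> [a v]; rewrite /split0 /rVcons; congr pair.
  have -> : (ord0 : 'I_n.+1) = lshift n (ord0 : 'I_1) by exact/val_inj.
  by rewrite (row_mxEl (a%:M) v) mxE eqxx mulr1n.
by apply/rowP => j; rewrite mxE (row_mxEr (a%:M) v).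
Qed.

Definition lebesgue_step n (m : {sigma_finite_measure set 'rV[R]_n -> \bar R}) :
  set 'rV[R]_n.+1 -> \bar R := pushforward (lebesgue_measure \x m)%E (@rVcons n).

Section lebesgue_step.
Variables (n : nat) (m : {sigma_finite_measure set 'rV[R]_n -> \bar R}).

Let step0 : lebesgue_step m set0 = 0%E.
Proof. by rewrite /lebesgue_step /pushforward preimage_set0 measure0. Qed.

Let step_ge0 A : (0 <= lebesgue_step m A)%E.
Proof. by rewrite /lebesgue_step /pushforward; apply: measure_ge0. Qed.

Let step_additive : semi_sigma_additive (lebesgue_step m).
Proof.
move=> F mF tF mUF; rewrite /lebesgue_step /pushforward preimage_bigcup.
apply: measure_semi_sigma_additive.
- by move=> k; rewrite -[X in measurable X]setTI; exact: measurable_rVcons.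
- apply/trivIsetP => /= i j _ _ ij; rewrite -preimage_setI.
  by move/trivIsetP : tF => /(_ _ _ _ _ ij) ->//; rewrite preimage_set0.
- by rewrite -preimage_bigcup -[X in measurable X]setTI; exact: measurable_rVcons.
Qed.

HB.instance Definition _ := isMeasure.Build _ _ _
  (lebesgue_step m) step0 step_ge0 step_additive.

Let step_sigma_finite : sigma_finite setT (lebesgue_step m).
Proof.
have /sigma_finiteP[F [TF ndF Foo]] := sigma_finiteT (@lebesgue_measure R).
have /sigma_finiteP[G [TG ndG Goo]] := sigma_finiteT m.
exists (fun k => @split0 n @^-1` (F k `*` G k)) => [|k].
  rewrite -preimage_bigcup [X in _ @^-1` X](_ : _ = setT) ?preimage_setT//.
  rewrite -setXTT TF TG predeqE => -[x y]; split; last first.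
    by move=> [/= [i _ Fx] [j _ Gy]]; exists (maxn i j) => //; split;
      [move: x Fx; exact/subsetPset/ndF/leq_maxl|
       move: y Gy; exact/subsetPset/ndG/leq_maxr].
  by move=> [i _ []/= ? ?]; split; exists i.
have [mF Fk] := Foo k; have [mG Gk] := Goo k; split.
  by rewrite -[X in measurable X]setTI; apply: measurable_split0 => //;
    exact: measurableX.
rewrite /lebesgue_step /pushforward -comp_preimage.
rewrite (_ : _ \o _ = id); last by apply/funext => x; exact: split0K.
by rewrite preimage_id product_measure1E// lte_mul_pinfty// ge0_fin_numE.
Qed.

HB.instance Definition _ := Measure_isSigmaFinite.Build _ _ _
  (lebesgue_step m) step_sigma_finite.

End lebesgue_step.

Fixpoint lebesgue_rV n : {sigma_finite_measure set 'rV[R]_n -> \bar R} :=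
  match n with
  | 0 => \d_(0 : 'rV[R]_0)
  | n'.+1 => lebesgue_step (lebesgue_rV n')
  end.

End Lebesgue_rV.

(** The norm the library puts on row vectors is the sup norm. *)
Definition enorm (R : realType) n (x : 'rV[R]_n) : R :=
  Num.sqrt (\sum_(i < n) x ord0 i ^+ 2).

Section Hausdorff.
Context (R : realType) (n : nat).
Let E := 'rV[R]_n.
Local Open Scope ereal_scope.

Definition ediam (U : set E) : \bar R :=
  ereal_sup [set (enorm (x - y))%:E | x in U & y in U].

(** [omega_s (diam U / 2)^s], with [omega_s] the volume of the unit ball of
    R^s; sets of diameter larger than [delta] are excluded by an infinite
    weight, and the empty set weighs 0 also for s = 0. *)
Definition hausdorff_gauge (s : nat) (delta : R) (U : set E) : \bar R :=
  if `[< U = set0 >] then 0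
  else if ediam U <= delta%:E then
    lebesgue_rV R s [set x | (enorm x <= 1)%R] * ((fine (ediam U) / 2) ^+ s)%:E
  else +oo.

(** With the power set as sigma-algebra, covers in [mu_ext] are by arbitrary
    sets. *)
Definition powerset_type := g_sigma_algebraType [set: set E].

Definition hausdorff_delta (s : nat) (delta : R) (X : set E) : \bar R :=
  @mu_ext _ powerset_type R (hausdorff_gauge s delta) X.

Definition hausdorff (s : nat) (X : set E) : \bar R :=
  ereal_sup [set hausdorff_delta s delta X | delta in [set e : R | (0 < e)%R]].

Variable s : nat.

Let gauge0 delta : hausdorff_gauge s delta set0 = 0.
Proof. by rewrite /hausdorff_gauge; case: asboolP. Qed.

Let gauge_ge0 delta U : 0 <= hausdorff_gauge s delta U.
Proof.
rewrite /hausdorff_gauge; case: asboolP => // /eqP/set0P[x Ux].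
case: ifPn => // ?; apply: mule_ge0; first exact: measure_ge0.
rewrite lee_fin exprn_ge0// divr_ge0// fine_ge0//.
apply: ereal_sup_ubound; exists x => //; exists x => //.
by rewrite subrr /enorm big1 ?sqrtr0// => i _; rewrite mxE expr0n.
Qed.

Let hausdorff0 : hausdorff s set0 = 0.
Proof.
apply/eqP; rewrite eq_le; apply/andP; split.
  by apply: ge_ereal_sup => _ [e _ <-]; rewrite /hausdorff_delta mu_ext0.
apply: ereal_sup_ubound; exists 1%R => //=.
by rewrite /hausdorff_delta mu_ext0.
Qed.

Let hausdorff_ge0 X : 0 <= hausdorff s X.
Proof.
apply: le_trans (ereal_sup_ubound _); last by exists 1%R => /=.
exact: mu_ext_ge0.
Qed.

Let le_hausdorff : {homo hausdorff s : A B / A `<=` B >-> A <= B}.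
Proof.
move=> A B AB; apply: ge_ereal_sup => _ [e e0 <-].
apply: le_trans (ereal_sup_ubound _); last by exists e.
exact: le_mu_ext.
Qed.

Let hausdorff_sigma_subadditive : sigma_subadditive (hausdorff s).
Proof.
move=> F; apply: ge_ereal_sup => _ [e e0 <-].
apply: (le_trans (mu_ext_sigma_subadditive _ _)) => //.
apply: lee_nneseries => [i _ _|i _]; first exact: mu_ext_ge0.
by apply: ereal_sup_ubound; exists e.
Qed.

HB.instance Definition _ := isOuterMeasure.Build R E (hausdorff s)
  hausdorff0 hausdorff_ge0 le_hausdorff hausdorff_sigma_subadditive.

End Hausdorff.

Section L2.
Context d (X : measurableType d) (R : realType).
Variable mu : {measure set X -> \bar R}.

Definition inL2 (D : set X) (f : X -> R) : Prop := f \_ D \in Lfun mu 2%:E.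

Definition L2norm (D : set X) (f : X -> R) : \bar R :=
  'N[mu]_2%:E [EFin \o (f \_ D)]%E.

Definition cvg_L2 (D : set X) (f : nat -> X -> R) (g : X -> R) : Prop :=
  [/\ forall n, inL2 D (f n), inL2 D g &
      (fun n => L2norm D (f n \- g)) @ \oo --> 0%E].

End L2.

Section one_variable.
Context (R : realType).

Definition C1_fun (q : R -> R) : Prop :=
  (forall s, derivable q s 1) /\ continuous q^`()%classic.

(** C^1([a, b]): the derivative in ]a, b[ extends continuously to [a, b]. *)
Definition C1_segment (a b : R) (f : R -> R) : Prop :=
  [/\ {within `[a, b], continuous f},
      forall t, t \in `]a, b[ -> derivable f t 1 &
      exists2 g : R -> R, {within `[a, b], continuous g} &
        forall t, t \in `]a, b[ -> f^`()%classic t = g t].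

Definition C1norm (rho : R) (q : R -> R) : R :=
  sup [set `|q s| | s in [set s | `|s| <= rho]] +
  sup [set `|q^`()%classic s| | s in [set s | `|s| <= rho]].

(** Indexed from 0: [Psi n] is the (n+1)-st basis function. *)
Definition orthonormal_basis (T : R) (Psi : nat -> R -> R) : Prop :=
  [/\ forall n, inL2 lebesgue_measure `[0, T] (Psi n),
      forall m n, \int[lebesgue_measure]_(t in `[0, T]) (Psi m t * Psi n t)
        = (m == n)%:R &
      forall f, inL2 lebesgue_measure `[0, T] f ->
        cvg_L2 lebesgue_measure `[0, T]
          (fun K t => \sum_(n < K)
            (\int[lebesgue_measure]_(s in `[0, T]) (f s * Psi n s)) * Psi n t)
          f].

End one_variable.

Section smooth.
Context (R : realType) (d : nat).
Local Notation E := 'rV[R]_d.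

Definition partial (i : 'I_d) (f : E -> R) (x : E) : R :=
  'D_(delta_mx ord0 i) f x.

Fixpoint Ck (k : nat) (f : E -> R) : Prop :=
  match k with
  | 0 => continuous f
  | k'.+1 => [/\ continuous f,
      forall i x, derivable f x (delta_mx ord0 i) &
      forall i, Ck k' (partial i f)]
  end.

Definition smooth (f : E -> R) : Prop := forall k, Ck k f.

Definition gradient (f : E -> R) (x : E) : E := \row_i partial i f x.

Definition boundary (Omega : set E) : set E := closure Omega `\` Omega°.

Definition defining_function (Omega : set E) (x : E) (rho : E -> R) : Prop :=
  [/\ smooth rho, gradient rho x != 0 &
      \forall y \near x, Omega y <-> rho y < 0].

Definition smooth_bounded_domain (Omega : set E) : Prop :=
  [/\ open Omega, connected Omega, Omega !=set0, bounded_set Omega &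
      forall x, boundary Omega x -> exists rho, defining_function Omega x rho].

(** The value at a boundary point does not depend on the defining function. *)
Definition outward_normal (Omega : set E) (x : E) : E :=
  let rho := xget (fun=> 0) [set rho | defining_function Omega x rho] in
  (enorm (gradient rho x))^-1 *: gradient rho x.

End smooth.

Section Sobolev.
Context (R : realType) (d : nat).
Local Notation E := 'rV[R]_d.
Local Notation leb := (lebesgue_rV R d).

Definition test_function (Omega : set E) (phi : E -> R) : Prop :=
  smooth phi /\
  exists K, [/\ compact K, K `<=` Omega & forall x, ~ K x -> phi x = 0].

Definition weak_partial (Omega : set E) (i : 'I_d) (u v : E -> R) : Prop :=
  forall phi, test_function Omega phi ->
    \int[leb]_(x in Omega) (u x * partial i phi x) =
    - \int[leb]_(x in Omega) (v x * phi x).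

(** An element of H^2(Omega) comes with representatives of its weak
    derivatives, which it determines almost everywhere. *)
Record H2 (Omega : set E) := MkH2 {
  H2val :> E -> R;
  wgrad : 'I_d -> E -> R;
  whess : 'I_d -> 'I_d -> E -> R;
  H2val_L2 : inL2 leb Omega H2val;
  wgrad_L2 : forall i, inL2 leb Omega (wgrad i);
  whess_L2 : forall i j, inL2 leb Omega (whess i j);
  wgradP : forall i, weak_partial Omega i H2val (wgrad i);
  whessP : forall i j, weak_partial Omega j (wgrad i) (whess i j)
}.

Definition laplacian (Omega : set E) (u : H2 Omega) (x : E) : R :=
  \sum_(i < d) whess u i i x.

(** Surface measure: (d-1)-dimensional Hausdorff measure on its own
    sigma-algebra of measurable sets. *)
Definition surface_outer_measure : {outer_measure set E -> \bar R} :=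
  @hausdorff R d d.-1.

Local Notation surface_type := (caratheodory_type surface_outer_measure).

Definition surface_measure : {measure set surface_type -> \bar R} :=
  (surface_outer_measure : set surface_type -> \bar R).

Definition L2_boundary (Omega : set E) (f : E -> R) : Prop :=
  @inL2 _ surface_type R surface_measure (boundary Omega) f.

(** [f] is the trace of the H^1 function [u] with weak gradient [du]: the
    trace is the continuous extension of the restriction to the boundary of
    functions smooth up to the boundary, which are dense in H^1(Omega). *)
Definition is_trace (Omega : set E) (u : E -> R) (du : 'I_d -> E -> R)
    (f : E -> R) : Prop :=
  exists phi : nat -> E -> R,
    [/\ forall n, smooth (phi n),
        cvg_L2 leb Omega phi u,
        forall i, cvg_L2 leb Omega (fun n => partial i (phi n)) (du i) &
        @cvg_L2 _ surface_type R surface_measure (boundary Omega) phi f].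

Definition has_trace (Omega : set E) (u : H2 Omega) (f : E -> R) : Prop :=
  is_trace Omega u (wgrad u) f.

(** The normal derivative is the sum of the [nu_i] times the traces of the
    first-order derivatives. *)
Definition has_normal_trace (Omega : set E) (u : H2 Omega) (g : E -> R) :
    Prop :=
  exists2 h : 'I_d -> E -> R,
    forall i, is_trace Omega (wgrad u i) (whess u i) (h i) &
    {ae surface_measure, forall x : surface_type, boundary Omega x ->
      g x = \sum_(i < d) outward_normal Omega x ord0 i * h i x}.

End Sobolev.

Section problem.
Context (R : realType) (d N : nat).
Local Notation E := 'rV[R]_d.
Local Notation leb := (lebesgue_rV R d).

Definition rdist (x0 x : E) : R := enorm (x - x0).

Definition weight (x0 : E) (b beta lambda : R) (x : E) : R :=
  expR (lambda * b `^ (- beta) * rdist x0 x `^ beta).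

Definition carleman_estimate (Omega : set E) (x0 : E) (b beta : R) : Prop :=
  exists C' lambda' : R, [/\ 0 < C', 0 < lambda' &
    forall lambda, lambda' <= lambda ->
    forall v : H2 Omega, has_trace v (fun=> 0) -> has_normal_trace v (fun=> 0) ->
    (C'%:E * \int[leb]_(x in Omega)
       (weight x0 b beta (2 * lambda) x *
        (lambda^-1 * (\sum_(i < d) \sum_(j < d) `|whess v i j x| ^+ 2)
         + lambda * (\sum_(i < d) `|wgrad v i x| ^+ 2)
         + lambda ^+ 3 * `|v x| ^+ 2))%:E
     <= \int[leb]_(x in Omega)
       (weight x0 b beta (2 * lambda) x * `|laplacian v x| ^+ 2)%:E)%E].

Section coefficients.
Variables (T : R) (Psi : nat -> R -> R).

Definition s_coef (m n : 'I_N) : R :=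
  \int[lebesgue_measure]_(t in `[0, T]) ((Psi n)^`()%classic t * Psi m t).

Definition q_coef (q : R -> R) (m : 'I_N) (s : 'I_N -> R) : R :=
  \int[lebesgue_measure]_(t in `[0, T])
    (q (\sum_(n < N) s n * Psi n t) * Psi m t).

Definition expansion (u : 'I_N -> E -> R) (x : E) (t : R) : R :=
  \sum_(n < N) u n x * Psi n t.

Definition Linfty_norm (Omega : set E) (w : E -> R -> R) : \bar R :=
  'N[(leb \x lebesgue_measure)]_+oo
    [EFin \o ((fun z : E * R => w z.1 z.2) \_ (Omega `*` `[0%R, T]))]%E.

Definition q_radius (M : R) : R :=
  M * Num.sqrt T * sup [set \sum_(n < N) `|Psi n t| | t in `[0, T]].

Definition cutoff (M s : R) : R :=
  Num.max (- (M * Num.sqrt T)) (Num.min s (M * Num.sqrt T)).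

Section functional.
Variable Omega : set E.

Definition admissible (f g : 'I_N -> E -> R) : set ('I_N -> H2 Omega) :=
  [set u | forall m, has_trace (u m) (f m) /\ has_normal_trace (u m) (g m)].

Definition solves (c : E -> R) (q : R -> R) (u : 'I_N -> H2 Omega) : Prop :=
  forall m, {ae leb, forall x, Omega x ->
    c x * (\sum_(n < N) s_coef m n * u n x) =
    laplacian (u m) x + q_coef q m (fun n => u n x)}.

Definition J (c : E -> R) (x0 : E) (b beta lambda : R) (F : 'I_N -> E -> R)
    (u : 'I_N -> H2 Omega) : \bar R :=
  (\sum_(m < N) \int[leb]_(x in Omega)
    (weight x0 b beta (2 * lambda) x *
     `|laplacian (u m) x - c x * (\sum_(n < N) s_coef m n * u n x) + F m x|
       ^+ 2)%:E)%E.

Definition is_minimizer (A : set ('I_N -> H2 Omega))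
    (F : ('I_N -> H2 Omega) -> \bar R) (u : 'I_N -> H2 Omega) : Prop :=
  A u /\ forall v, A v -> (F u <= F v)%E.

Definition iterates (c : E -> R) (q : R -> R) (x0 : E) (b beta M lambda : R)
    (f g : 'I_N -> E -> R) (u : nat -> 'I_N -> H2 Omega) : Prop :=
  is_minimizer (admissible f g) (J c x0 b beta lambda (fun _ _ => 0)) (u 0%N) /\
  forall k, is_minimizer (admissible f g)
    (J c x0 b beta lambda
      (fun m x => q_coef q m (fun n => cutoff M (u k n x))))
    (u k.+1).

End functional.
End coefficients.
End problem.

(* Main.v *)
Require Import Defs.
From mathcomp Require Import all_boot all_order all_algebra.
From mathcomp Require Import all_classical all_reals all_analysis.
From mathcomp Require Import measurable_realfun ess_sup_inf ring lra.
Import Order.TTheory GRing.Theory Num.Theory.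
Import numFieldNormedType.Exports.
Local Open Scope classical_set_scope.
Local Open Scope ring_scope.

(** Let [v] be the exact solution and [e_k = u^(k) - v], let
    [w = exp (lambda b^-beta r^beta)], and write [L] for the linear operator
    [u |-> Laplacian u_m - c sum_n s_mn u_n]. Since [|v(x, t)| <= M] almost
    everywhere, expanding in the orthonormal [Psi_n] gives [|v_n| <= M sqrt T], so
    the cut-off [P] does not act on [v] and [L v + q (P v) = 0]. The functional
    [J^(k)] is the squared norm of an affine map, so the parallelogram law for its
    minimizer [u^(k)] and the admissible [v] bounds [|w L e_k|^2] by
    [2 |w (q (P u^(k-1)) - q (P v))|^2]; no first-order condition is needed. The
    latter is at most a constant times [|w e_(k-1)|^2] because [q] is Lipschitz on
    the range of the cut-off. The Carleman estimate applied to [e_k], which has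
    zero Cauchy data, bounds [lambda^3 |w e_k|^2] by [|w Laplacian e_k|^2] up to a
    constant, and for large [lambda] it absorbs the zero-order part of [L e_k]. *)

(** * Square-integrable functions *)

Section L2_theory.
Context d (X : measurableType d) (R : realType).
Variable mu : {measure set X -> \bar R}.
Implicit Types (D : set X) (f g : X -> R).

Lemma patch_linear D (a b : R) f g :
  (fun x => a * f x + b * g x) \_ D = a *: (f \_ D) + b *: (g \_ D).
Proof.
apply/funext => x; rewrite /patch; case: ifPn => xD.
  by rewrite /GRing.add /GRing.scale /= xD.
by rewrite /GRing.add /GRing.scale /= (negPf xD) !scaler0 addr0.
Qed.

Lemma patch_scale D (a : R) f : (fun x => a * f x) \_ D = a *: (f \_ D).
Proof.
by apply/funext => x; rewrite /patch /GRing.scale/=; case: ifPn => xD //; rewrite scaler0.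
Qed.

Lemma inL2_measurable D f : inL2 mu D f -> measurable_fun setT (f \_ D).
Proof. by rewrite /inL2 => /andP[/set_mem]. Qed.

Lemma inL2_L2norm_lty D f : inL2 mu D f -> (L2norm mu D f < +oo)%E.
Proof. by rewrite /inL2 => /andP[_ /set_mem]. Qed.

Lemma inL2P D f : measurable_fun setT (f \_ D) -> (L2norm mu D f < +oo)%E ->
  inL2 mu D f.
Proof. by move=> mf lf; apply/andP; split; apply/mem_set. Qed.

Lemma inL2_linear D (a b : R) f g : inL2 mu D f -> inL2 mu D g ->
  inL2 mu D (fun x => a * f x + b * g x).
Proof.
rewrite /inL2 patch_linear => fD gD.
have h : (1 <= 2%:E :> \bar R)%E by rewrite lee_fin ler1n.
have [h0 hl] := Lfun_submod_closed mu h.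
by apply: (hl) => //; rewrite -[_ *: _]addr0; apply: (hl).
Qed.

Lemma L2normZ D (a : R) f : inL2 mu D f ->
  L2norm mu D (fun x => a * f x) = (`|a|%:E * L2norm mu D f)%E.
Proof.
move=> fD; rewrite /L2norm.
have h : (1 <= 2%:E :> \bar R)%E by rewrite lee_fin ler1n.
by rewrite patch_scale; exact: (@LnormZ _ _ _ mu 2%:E h (Lfun_Sub h fD) a).
Qed.

Lemma L2norm_linear_le D (a b : R) f g : inL2 mu D f -> inL2 mu D g ->
  (L2norm mu D (fun x => a * f x + b * g x)%R
   <= `|a|%:E * L2norm mu D f + `|b|%:E * L2norm mu D g)%E.
Proof.
move=> fD gD.
have mf := inL2_measurable _ _ fD; have mg := inL2_measurable _ _ gD.
rewrite -!L2normZ// /L2norm patch_linear.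
rewrite !patch_scale; apply: (@minkowski_EFin _ _ _ mu (a *: (f \_ D)) (b *: (g \_ D)) 2).
- by apply: measurable_funM.
- by apply: measurable_funM.
- by rewrite ler1n.
Qed.

Lemma cvg_L2_linear D (a b : R) (f g : nat -> X -> R) (f' g' : X -> R) :
  cvg_L2 mu D f f' -> cvg_L2 mu D g g' ->
  cvg_L2 mu D (fun n x => a * f n x + b * g n x) (fun x => a * f' x + b * g' x).
Proof.
move=> [fD f'D ff'] [gD g'D gg']; split.
- by move=> n; apply: inL2_linear.
- exact: inL2_linear.
have sub h k : inL2 mu D h -> inL2 mu D k -> inL2 mu D (h \- k).
  move=> hD kD; rewrite (_ : h \- k = fun x => 1 * h x + (-1) * k x).
    exact: inL2_linear.
  by apply/funext => x; rewrite mul1r mulN1r.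
apply: (@squeeze_cvge _ _ _ _ (cst 0%E) _
  (fun n => `|a|%:E * L2norm mu D (f n \- f')%R + `|b|%:E * L2norm mu D (g n \- g')%R)%E).
- apply: nearW => n; rewrite Lnorm_ge0/=.
  apply: le_trans (L2norm_linear_le _ a b _ _ (sub _ _ (fD n) f'D) (sub _ _ (gD n) g'D)).
  rewrite le_eqVlt; apply/orP; left; apply/eqP; congr L2norm.
  by apply/funext => x /=; ring.
- exact: cvg_cst.
- rewrite (_ : 0 = `|a|%:E * 0 + `|b|%:E * 0)%E; last by rewrite !mule0 adde0.
  apply: cvgeD; [by rewrite !mule0|exact: cvgeZl|exact: cvgeZl].
Qed.

Lemma inL2_measurable_in D f : measurable D -> inL2 mu D f -> measurable_fun D f.
Proof. by move=> mD /inL2_measurable; rewrite -(measurable_restrictT _ mD). Qed.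

(** The identity lives in the extended reals, infinite norm included, so finiteness can be deduced
    from it rather than assumed. *)
Lemma L2norm_sqr D f : measurable D -> measurable_fun D f ->
  (L2norm mu D f ^+ 2 = \int[mu]_(x in D) (f x ^+ 2)%:E)%E.
Proof.
move=> mD mf; have E : (L2norm mu D f `^ 2 = \int[mu]_x (`|(EFin \o f \_ D) x| `^ 2))%E.
  by apply: poweR_Lnorm; rewrite pnatr_eq0.
have -> : (L2norm mu D f ^+ 2)%E = (L2norm mu D f `^ 2)%E.
  have := Lnorm_ge0 mu 2 (EFin \o f \_ D); rewrite -/(L2norm mu D f).
  case: (L2norm mu D f) => [r r0||//]; last by rewrite poweRyr// expe2 mulyy.
  by rewrite poweR_EFin powR_mulrn.
rewrite E [RHS]integral_mkcond; apply: eq_integral => x _ /=.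
rewrite /patch; case: ifP => _ /=.
  by rewrite powR_mulrn// real_normK// num_real.
by rewrite normr0 powR0// pnatr_eq0.
Qed.

Lemma inL2_integral_lty D f : measurable D -> inL2 mu D f ->
  (\int[mu]_(x in D) (f x ^+ 2)%:E < +oo)%E.
Proof.
move=> mD fD; rewrite -L2norm_sqr//; last exact: inL2_measurable_in.
rewrite expe2; apply: lte_mul_pinfty; rewrite ?Lnorm_ge0//.
  by rewrite ge0_fin_numE ?Lnorm_ge0 ?inL2_L2norm_lty.
exact: inL2_L2norm_lty.
Qed.

Lemma integral_inL2 D f : measurable D -> measurable_fun D f ->
  (\int[mu]_(x in D) (f x ^+ 2)%:E < +oo)%E -> inL2 mu D f.
Proof.
move=> mD mf; rewrite -L2norm_sqr// => h; apply: inL2P.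
  by rewrite -(measurable_restrictT _ mD).
rewrite ltey; apply/eqP => E; move: h; rewrite E expe2 mulyy ltxx//.
Qed.

End L2_theory.

(** * Lebesgue measure on row vectors *)

Section row_vectors.
Context (R : realType) (n : nat).
Local Notation E := 'rV[R]_n.

(** The norm is the sup norm, so a ball is a finite intersection of coordinate preimages of
    intervals. *)
Lemma measurable_rV_ball (x : E) (e : R) : measurable (ball x e).
Proof.
(* A ball carries the positivity of its radius; for [n = 0] the coordinate description alone would
   give the whole space even when [e <= 0]. *)
have [e0|e0] := ltP 0 e; last first.
  rewrite (_ : ball x e = set0) ?measurable0//.
  by apply/seteqP; split => // y [] /=; rewrite ltNge e0.
rewrite (_ : ball x e =
  \bigcap_(i in [set: 'I_n]) (fun y : E => y ord0 i) @^-1` ball (x ord0 i) e).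
  apply: fin_bigcap_measurable => // i _; rewrite -[X in measurable X]setTI.
  by apply: measurable_coord => //; exact: measurable_ball.
apply/seteqP; split => [y [_ xy] i _|y xy]; first exact: xy.
by split => // i j; rewrite (ord1 i); exact: xy.
Qed.

(** The balls with rational centre and radius [1 / (k + 1)] are countably many, and [U] is the union
    of those it contains. *)
Lemma open_measurable_rV (U : set E) : open U -> measurable U.
Proof.
move=> oU.
pose B (p : 'rV[rat]_n * nat) : set E :=
  ball (map_mx ratr p.1 : E) (p.2.+1%:R^-1).
rewrite (_ : U = \bigcup_p (if `[< B p `<=` U >] then B p else set0)).
  apply: countable_bigcupT_measurable => [|p]; first exact: countableP.
  by case: ifP => _; [exact: measurable_rV_ball|exact: measurable0].
apply/seteqP; split => [x Ux|x [p _]]; last first.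
  by case: asboolP => // + Bx; apply.
have /nbhs_ballP[e /= e0 xeU] : nbhs x U by exact: open_nbhs_nbhs.
(* With [2 r <= e], a ball of radius [r] whose centre is within [r] of [x] contains [x] and stays
   inside [ball x e]. *)
have [k [r [rE r0 re]]] : exists k, exists r : R, [/\ r = k.+1%:R^-1, 0 < r & r + r <= e].
  exists (Num.truncn (2 / e)), (Num.truncn (2 / e)).+1%:R^-1.
  split=> //.
  have h : 2 / e < (Num.truncn (2 / e)).+1%:R := truncnS_gt _.
  rewrite -mulr2n -(mulr_natl (_^-1)) ler_pdivrMr// mulrC -ler_pdivrMr//.
  exact: ltW.
have Q i : exists q : rat, ratr q \in `](x ord0 i - r), (x ord0 i + r)[.
  by apply: rat_in_itvoo; lra.
pose q : 'rV[rat]_n := \row_i projT1 (cid (Q i)).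
have qx i : `|x ord0 i - ratr (q ord0 i)| < r.
  rewrite mxE; case: cid => s /=; rewrite in_itv/= => /andP[h1 h2].
  by rewrite ltr_norml; apply/andP; split; lra.
exists (q, k) => //; case: asboolP => [_|abs].
  by rewrite /B /= -rE; split => // i j; rewrite (ord1 i) mxE /ball/= distrC.
exfalso; apply: abs => y [_ /= qy]; apply: xeU; split => //= i j; rewrite (ord1 i).
have := qy ord0 j; rewrite mxE /ball/= => h.
rewrite (_ : _ - _ = (x ord0 j - ratr (q ord0 j)) + (ratr (q ord0 j) - y ord0 j)); last by ring.
apply: le_lt_trans (ler_normD _ _) _; apply: lt_le_trans re.
by apply: ltrD; [exact: qx|rewrite rE; exact: h].
Qed.

Lemma continuous_measurable_rV (f : E -> R) : continuous f -> measurable_fun setT f.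
Proof.
move=> /continuousP cf; apply: (measurability _ (RGenOpens.measurableE R)).
move=> _ [_ [a [b ->]] <-]; rewrite setTI; apply: open_measurable_rV.
by apply: cf; exact: interval_open.
Qed.

End row_vectors.

Definition rV_box (R : realType) n (K : R) : set 'rV[R]_n :=
  [set x | forall i, `|x ord0 i| <= K].

Lemma measurable_rV_box (R : realType) n (K : R) :
  measurable (rV_box R n K).
Proof.
rewrite (_ : rV_box _ _ _ =
  \bigcap_(i in [set: 'I_n]) (fun y : 'rV[R]_n => y ord0 i) @^-1` `[-K, K]).
  apply: fin_bigcap_measurable => // i _; rewrite -[X in measurable X]setTI.
  by apply: measurable_coord => //.
apply/seteqP; split => y /= h i; first by move=> _ /=; rewrite in_itv/= -ler_norml.
by have := h i I; rewrite /= in_itv/= -ler_norml.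
Qed.

(** Induction on the dimension: along [rVcons] the box pulls back to a segment times the
    lower-dimensional box, and dimension 0 carries a Dirac mass. *)
Lemma lebesgue_rV_box_lty (R : realType) n (K : R) :
  (lebesgue_rV R n (rV_box R n K) < +oo)%E.
Proof.
elim: n => [|n IH] /=.
  by rewrite diracE ltry.
rewrite /lebesgue_step /pushforward.
rewrite (_ : _ @^-1` _ = `[-K, K] `*` rV_box R n K).
  rewrite product_measure1E//; last exact: measurable_rV_box.
  apply: lte_mul_pinfty => //; rewrite ge0_fin_numE//.
  apply: (@le_lt_trans _ _ (lebesgue_measure `[-K, K])) => //.
  by rewrite lebesgue_measure_itv/=; case: ifP => // _; rewrite -EFinD ltry.
apply/seteqP; split => -[a v] /=.
  move=> h; split => /=.
    have := h (lshift n (ord0 : 'I_1)); rewrite /rVcons (row_mxEl (a%:M) v) mxE eqxx mulr1n.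
    by rewrite in_itv/= ler_norml.
  by move=> i; have := h (rshift 1 i); rewrite /rVcons (row_mxEr (a%:M) v).
rewrite in_itv/= -ler_norml => -[h1 h2]; rewrite -[n.+1]/(1 + n)%N => i.
case: (split_ordP i) => j ->.
  by rewrite /rVcons (row_mxEl (a%:M) v) (ord1 j) mxE eqxx mulr1n.
by rewrite /rVcons (row_mxEr (a%:M) v).
Qed.

Lemma bounded_lebesgue_lty (R : realType) n (A : set 'rV[R]_n) :
  measurable A -> bounded_set A -> (lebesgue_rV R n A < +oo)%E.
Proof.
move=> mA [M [Mreal bM]]; apply: le_lt_trans (lebesgue_rV_box_lty R n (M + 1)).
apply: le_measure; rewrite ?inE//; first exact: measurable_rV_box.
move=> v Av i; apply: le_trans (bM (M + 1) _ _ Av); last by rewrite ltrDl.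
have /mapP[j Hj ->] : `|v ord0 i| \in [seq `|v x.1 x.2| | x : 'I_1 * 'I_n].
  by apply/mapP; exists (ord0, i) => //=; rewrite mem_enum.
by rewrite [leRHS]/Num.Def.normr /= mx_normrE; apply/bigmax_geP; right => /=; exists j.
Qed.

(** Continuity holds on the whole space, so [A] can be enclosed in a closed ball, which is compact
    in finite dimension. *)
Lemma continuous_bounded_on (R : realType) n (A : set 'rV[R]_n) (f : 'rV[R]_n -> R) :
  bounded_set A -> continuous f -> exists2 B, 0 <= B & forall x, A x -> `|f x| <= B.
Proof.
move=> [M [Mreal bM]] cf.
have /compact_bounded : compact (f @` [set x | `|x| <= M + 1]).
  apply: continuous_compact; first exact: continuous_subspaceT.
  apply: bounded_closed_compact.
    exists (M + 1); split; first exact: num_real.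
    by move=> a Ma x /= /le_trans; apply; exact: ltW.
  have := closed_comp (in1W (@norm_continuous _ 'rV[R]_n)) (@closed_le R (M + 1)).
  exact.
move=> [K [Kreal bK]]; exists (`|K| + 1) => [|x Ax]; first by rewrite addr_ge0.
apply: (bK (`|K| + 1)); first by have := ler_norm K; lra.
by exists x => //=; apply: bM => //; rewrite ltrDl.
Qed.

(** * Linear combinations in H^2 *)

Section smooth_linear.
Context (R : realType) (d : nat).
Local Notation E := 'rV[R]_d.
Implicit Types (f g : E -> R) (a b : R).

Lemma derivable_linear a b f g (x v : E) : derivable f x v -> derivable g x v ->
  derivable (fun x => a * f x + b * g x) x v.
Proof. by move=> df dg; apply: derivableD; apply: derivableZ. Qed.

Lemma partial_linear a b f g i :
  (forall x, derivable f x (delta_mx ord0 i)) ->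
  (forall x, derivable g x (delta_mx ord0 i)) ->
  partial i (fun x => a * f x + b * g x) =
  (fun x => a * partial i f x + b * partial i g x).
Proof.
move=> df dg; apply/funext => x; rewrite /partial.
by rewrite -[RHS]/(a *: _ + b *: _) -!deriveZ// -deriveD//; exact: derivableZ.
Qed.

Lemma continuous_linear a b f g : continuous f -> continuous g ->
  continuous (fun x => a * f x + b * g x).
Proof.
move=> cf cg x; apply: (@continuousD _ _ _ (fun x => a * f x) (fun x => b * g x)).
  by apply: continuousM; [exact: cst_continuous|exact: cf].
by apply: continuousM; [exact: cst_continuous|exact: cg].
Qed.

Lemma Ck_linear k a b f g : Ck k f -> Ck k g -> Ck k (fun x => a * f x + b * g x).
Proof.
elim: k f g => [|k IH] f g; first exact: continuous_linear.
move=> [cf df Df] [cg dg Dg]; split.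
- exact: continuous_linear.
- by move=> i x; exact: derivable_linear.
- move=> i; rewrite (partial_linear _ _ _ _ _ (df i) (dg i)).
  by apply: IH; [exact: Df|exact: Dg].
Qed.

Lemma smooth_linear a b f g : smooth f -> smooth g ->
  smooth (fun x => a * f x + b * g x).
Proof. by move=> sf sg k; exact: Ck_linear. Qed.

(** The same combination of the two smooth approximating sequences approximates the combined
    function, its gradient and its trace. *)
Lemma is_trace_linear (Omega : set E) a b (u v : E -> R) du dv f g :
  is_trace Omega u du f -> is_trace Omega v dv g ->
  is_trace Omega (fun x => a * u x + b * v x) (fun i x => a * du i x + b * dv i x)
    (fun x => a * f x + b * g x).
Proof.
move=> [p [sp pu dpu pf]] [q [sq qv dqv qg]].
exists (fun n x => a * p n x + b * q n x); split.
- by move=> n; exact: smooth_linear.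
- exact: cvg_L2_linear.
- move=> i; rewrite [X in cvg_L2 _ _ X](_ : _ =
    fun n x => a * partial i (p n) x + b * partial i (q n) x).
    exact: cvg_L2_linear.
  apply/funext => n; rewrite partial_linear// => x.
    by have [_ + _] := sp n 1%N; apply.
  by have [_ + _] := sq n 1%N; apply.
- exact: cvg_L2_linear.
Qed.

End smooth_linear.

(** [|f| <= 1 + f ^ 2], and both terms have a finite integral over a set of finite measure. *)
Lemma inL2_integrable d (X : measurableType d) (R : realType)
    (mu : {measure set X -> \bar R}) (D : set X) (f : X -> R) :
  measurable D -> (mu D < +oo)%E -> inL2 mu D f -> mu.-integrable D (EFin \o f).
Proof.
move=> mD fD hf; have mf := inL2_measurable_in _ _ _ _ _ _ mD hf.
apply/integrableP; split; first exact/measurable_EFinP.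
apply: (@le_lt_trans _ _ (\int[mu]_(x in D) (1 + (f x ^+ 2)%:E))%E).
  apply: ge0_le_integral => //.
  - by apply: measurableT_comp => //; exact/measurable_EFinP.
  - by apply: emeasurable_funD => //; apply/measurable_EFinP; exact: measurable_funX.
  - move=> x _; rewrite /= -EFinD lee_fin -(real_normK (num_real (f x))).
    by have := sqr_ge0 (`|f x| - 1); have := normr_ge0 (f x); nra.
rewrite ge0_integralD//; last 2 first.
- by move=> x _; rewrite lee_fin sqr_ge0.
- by apply/measurable_EFinP; exact: measurable_funX.
by rewrite integral_cst// mul1e; apply: lte_add_pinfty => //; exact: inL2_integral_lty.
Qed.

Section H2_linear.
Context (R : realType) (d : nat).
Local Notation E := 'rV[R]_d.
Local Notation leb := (lebesgue_rV R d).
Variable Omega : set E.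
Hypotheses (mO : measurable Omega) (bO : bounded_set Omega).

Lemma inL2_mul_continuous_integrable (u phi : E -> R) :
  inL2 leb Omega u -> continuous phi ->
  leb.-integrable Omega (EFin \o (fun x => u x * phi x)).
Proof.
move=> hu cphi.
have fO := bounded_lebesgue_lty _ _ _ mO bO.
have [B B0 hB] := continuous_bounded_on _ _ _ _ bO cphi.
apply: (@integrableMl _ _ _ leb _ mO (EFin \o u) phi).
- exact: inL2_integrable.
- apply: measurable_funTS; exact: continuous_measurable_rV cphi.
- exists B; split; first exact: num_real.
  by move=> a Ba x Ox; apply: le_trans (ltW Ba); exact: hB.
Qed.

(** Splitting a real-valued integral requires integrability, which an L^2 function times a
    continuous one has on a bounded set. *)
Lemma weak_partial_linear i (a b : R) u v u' v' :
  inL2 leb Omega u -> inL2 leb Omega v -> inL2 leb Omega u' -> inL2 leb Omega v' ->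
  weak_partial Omega i u u' -> weak_partial Omega i v v' ->
  weak_partial Omega i (fun x => a * u x + b * v x) (fun x => a * u' x + b * v' x).
Proof.
move=> hu hv hu' hv' wu wv phi tphi.
have [sphi _] := tphi.
have [cphi _ cdphi] := sphi 1%N; have {}cdphi := cdphi i.
have L (f g psi : E -> R) : inL2 leb Omega f -> inL2 leb Omega g -> continuous psi ->
    \int[leb]_(x in Omega) ((a * f x + b * g x) * psi x) =
    a * \int[leb]_(x in Omega) (f x * psi x) + b * \int[leb]_(x in Omega) (g x * psi x).
  move=> hf hg cpsi.
  have If := inL2_mul_continuous_integrable _ _ hf cpsi.
  have Ig := inL2_mul_continuous_integrable _ _ hg cpsi.
  rewrite -!RintegralZl// -RintegralD//; last 2 first.
  - exact: (@integrableZl _ _ _ leb _ mO a _ If).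
  - exact: (@integrableZl _ _ _ leb _ mO b _ Ig).
  by apply: eq_Rintegral => x _; ring.
by rewrite !L// wu// wv//; ring.
Qed.

(** The chosen representatives of the derivatives are combined too, so that the Laplacian of a
    combination is computed at every point, not just almost everywhere. *)
Definition H2_linear (a b : R) (u v : H2 Omega) : H2 Omega :=
  @MkH2 R d Omega (fun x => a * u x + b * v x)
    (fun i x => a * wgrad u i x + b * wgrad v i x)
    (fun i j x => a * whess u i j x + b * whess v i j x)
    (inL2_linear _ _ _ _ _ _ _ _ _ (H2val_L2 u) (H2val_L2 v))
    (fun i => inL2_linear _ _ _ _ _ _ _ _ _ (wgrad_L2 u i) (wgrad_L2 v i))
    (fun i j => inL2_linear _ _ _ _ _ _ _ _ _ (whess_L2 u i j) (whess_L2 v i j))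
    (fun i => weak_partial_linear _ _ _ _ _ _ _ (H2val_L2 u) (H2val_L2 v)
      (wgrad_L2 u i) (wgrad_L2 v i) (wgradP u i) (wgradP v i))
    (fun i j => weak_partial_linear _ _ _ _ _ _ _ (wgrad_L2 u i) (wgrad_L2 v i)
      (whess_L2 u i j) (whess_L2 v i j) (whessP u i j) (whessP v i j)).

Lemma laplacian_linear a b u v x :
  laplacian (H2_linear a b u v) x = a * laplacian u x + b * laplacian v x.
Proof. by rewrite /laplacian /= !mulr_sumr -big_split. Qed.

Lemma has_trace_linear a b (u v : H2 Omega) f g : has_trace u f -> has_trace v g ->
  has_trace (H2_linear a b u v) (fun x => a * f x + b * g x).
Proof. exact: is_trace_linear. Qed.

Lemma has_normal_trace_linear a b (u v : H2 Omega) f g :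
  has_normal_trace u f -> has_normal_trace v g ->
  has_normal_trace (H2_linear a b u v) (fun x => a * f x + b * g x).
Proof.
move=> [h hu fh] [k kv gk]; exists (fun i x => a * h i x + b * k i x).
  by move=> i; exact: is_trace_linear.
apply: filterS2 fh gk => x fh gk Ox; rewrite fh// gk// !mulr_sumr -big_split/=.
by apply: eq_bigr => i _; ring.
Qed.

End H2_linear.

(** * The nonlinearity and the cut-off *)

Section one_variable.
Context (R : realType).

Lemma segment_continuous_bounded (a b : R) (f : R -> R) :
  {within `[a, b], continuous f} ->
  exists2 B, 0 <= B & forall t, t \in `[a, b] -> `|f t| <= B.
Proof.
move=> cf; have /compact_bounded[M [Mreal bM]] : compact (f @` `[a, b]).
  by apply: continuous_compact => //; exact: segment_compact.
exists (`|M| + 1) => [|t tab]; first by rewrite addr_ge0.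
apply: (bM (`|M| + 1)); first by have := ler_norm M; lra.
by exists t.
Qed.

Lemma C1norm_derive_le (rho : R) (q : R -> R) s : C1_fun q -> `|s| <= rho ->
  `|q^`()%classic s| <= C1norm rho q.
Proof.
move=> [dq cq'] srho.
have cq : continuous q.
  by move=> x; apply: differentiable_continuous; apply/derivable1_diffP; exact: dq.
have [B B0 hB] := segment_continuous_bounded (- rho) rho q (continuous_subspaceT cq).
have [B' B'0 hB'] := segment_continuous_bounded (- rho) rho _ (continuous_subspaceT cq').
rewrite /C1norm; apply: (@le_trans _ _
  (sup [set `|q^`()%classic s| | s in [set s | `|s| <= rho]])).
  apply: ub_le_sup; last by exists s.
  by exists B' => _ [t /= trho <-]; apply: hB'; rewrite in_itv/= -ler_norml.
rewrite lerDr; apply: le_trans (normr_ge0 (q s)) _; apply: ub_le_sup; last by exists s.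
by exists B => _ [t /= trho <-]; apply: hB; rewrite in_itv/= -ler_norml.
Qed.

(** Mean value theorem: the intermediate point lies between [x] and [y], hence still in the interval
    over which the norm is taken. *)
Lemma C1norm_lipschitz (rho : R) (q : R -> R) x y : C1_fun q ->
  `|x| <= rho -> `|y| <= rho -> `|q x - q y| <= C1norm rho q * `|x - y|.
Proof.
move=> Cq; wlog : x y / y <= x => [W|yx] xr yr.
  have [|/ltW] := leP y x; first by move=> ?; exact: W.
  by move=> /W h; rewrite distrC (distrC x); exact: h.
have [dq _] := Cq.
have [c cxy ->] : exists2 c, c \in `[y, x]%R & q x - q y = q^`()%classic c * (x - y).
  apply: (MVT_segment yx) => [z _|].
    by rewrite derive1E; apply/derivableP; exact: dq.
  apply: continuous_subspaceT => z; apply: differentiable_continuous.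
  by apply/derivable1_diffP; exact: dq.
rewrite normrM ler_wpM2r//; apply: C1norm_derive_le => //.
move: xr yr cxy; rewrite !ler_norml in_itv/= => /andP[? ?] /andP[? ?] /andP[? ?].
by apply/andP; split; lra.
Qed.

Lemma cutoff_le (T M s : R) : 0 <= M -> `|cutoff T M s| <= M * Num.sqrt T.
Proof.
move=> M0; have h : 0 <= M * Num.sqrt T by rewrite mulr_ge0// sqrtr_ge0.
rewrite /cutoff ler_norml; apply/andP; split; first by rewrite le_max lexx.
by rewrite ge_max ge_min lexx orbT andbT; lra.
Qed.

Lemma cutoff_id (T M s : R) : `|s| <= M * Num.sqrt T -> cutoff T M s = s.
Proof.
rewrite ler_norml => /andP[h1 h2]; rewrite /cutoff min_l//.
by rewrite max_r.
Qed.

Lemma cutoff_lipschitz (T M s s' : R) :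
  `|cutoff T M s - cutoff T M s'| <= `|s - s'|.
Proof.
have maxL (a x y : R) : `|Num.max a x - Num.max a y| <= `|x - y|.
  rewrite ler_norml !maxElt; case: (ler0P (x - y)) => ?;
    do ![case: ifPn; rewrite -?leNgt => ?]; by apply/andP; split; lra.
have minL (a x y : R) : `|Num.min x a - Num.min y a| <= `|x - y|.
  rewrite ler_norml !minElt; case: (ler0P (x - y)) => ?;
    do ![case: ifPn; rewrite -?leNgt => ?]; by apply/andP; split; lra.
exact: le_trans (maxL _ _ _) (minL _ _ _).
Qed.

End one_variable.

(** Integrability and the formula are proved together because additivity at each induction step
    needs the integrability of the tail. *)
Lemma RintegralZ_sum d (X : measurableType d) (R : realType)
    (mu : {measure set X -> \bar R}) (D : set X) (I : Type) (r : seq I)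
    (s : I -> R) (F : I -> X -> R) : measurable D ->
  (forall i, mu.-integrable D (EFin \o F i)) ->
  mu.-integrable D (EFin \o (fun x => \sum_(i <- r) s i * F i x)) /\
  \int[mu]_(x in D) (\sum_(i <- r) s i * F i x) =
  \sum_(i <- r) s i * \int[mu]_(x in D) F i x.
Proof.
move=> mD iF; elim: r => [|i r [IHi IHe]].
  split; last by rewrite big_nil; under eq_Rintegral do rewrite big_nil; rewrite Rintegral_cst// mul0r.
  rewrite (_ : _ \o _ = cst 0%E); first exact: integrable0.
  by apply/funext => x /=; rewrite big_nil.
have iZ : mu.-integrable D (EFin \o (fun x => s i * F i x)).
  exact: (@integrableZl _ _ _ mu _ mD (s i) _ (iF i)).
split.
  rewrite (_ : _ \o _ = (EFin \o (fun x => s i * F i x)%R) \+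
      (EFin \o (fun x => \sum_(i <- r) s i * F i x)%R))%E.
    exact: integrableD.
  by apply/funext => x /=; rewrite big_cons EFinD.
rewrite big_cons -IHe -RintegralZl// -RintegralD//.
by apply: eq_Rintegral => x _; rewrite big_cons.
Qed.

(** * Coefficients in the time basis *)

Section coefficients.
Context (R : realType) (T : R) (Psi : nat -> R -> R) (N : nat).
Hypotheses (T0 : 0 < T) (oPsi : orthonormal_basis T Psi).
Hypothesis cPsi : forall n, C1_segment 0 T (Psi n).
Local Notation I := `[0, T]%classic.
Local Notation mu := (@lebesgue_measure R).

Lemma lebesgue_segment : mu I = T%:E.
Proof. by rewrite lebesgue_measure_itv/= lte_fin T0 oppr0 adde0. Qed.

Lemma lebesgue_segment_lty : (mu I < +oo)%E.
Proof. by rewrite lebesgue_segment ltry. Qed.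

Lemma measurable_Psi n : measurable_fun I (Psi n).
Proof.
by have [c _ _] := cPsi n; exact: subspace_continuous_measurable_fun.
Qed.

(** The supremum that occurs in [q_radius]: unfolding gives [q_radius N T Psi M = M * sqrt T *
    Psi_sup]. *)
Definition Psi_sup : R := sup [set \sum_(n < N) `|Psi n t| | t in I].

Lemma Psi_sum_le t : I t -> \sum_(n < N) `|Psi n t| <= Psi_sup.
Proof.
move=> tI; apply: ub_le_sup; last by exists t.
pose B n := projT1 (cid2 (segment_continuous_bounded _ _ _ _ (let: And3 c _ _ := cPsi n in c))).
exists (\sum_(n < N) B n) => _ [x xI <-]; apply: ler_sum => n _.
by rewrite /B; case: cid2 => b /= b0; exact.
Qed.

Lemma Psi_le (n : 'I_N) t : I t -> `|Psi n t| <= Psi_sup.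
Proof.
move=> /Psi_sum_le; apply: le_trans; rewrite (bigD1 n)//= lerDl.
exact: sumr_ge0.
Qed.

Lemma Psi_comb_le (s : 'I_N -> R) K t : I t -> (forall n, `|s n| <= K) ->
  `|\sum_(n < N) s n * Psi n t| <= K * Psi_sup.
Proof.
move=> tI sK; apply: le_trans (ler_norm_sum _ _ _) _.
(* For [N = 0] nothing forces [K >= 0]; there [Psi_sup] is the supremum of [{0}] and both sides
   vanish. *)
case: (ltnP 0 N) => [N0|N0]; last first.
  have h : forall m (F : 'I_m -> R), (m <= 0)%N -> \sum_(n < m) F n = 0.
    by move=> m F; rewrite leqn0 => /eqP m0; move: F; rewrite m0 => F; rewrite big_ord0.
  have E0 : Psi_sup = 0.
    rewrite /Psi_sup (_ : [set _ | _ in _] = [set 0]); first exact: sup1.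
    apply/seteqP; split => [_ [u _ <-]|_ ->]; first exact: h.
    by exists t => //; exact: h.
  by rewrite E0 mulr0 h.
have K0 : 0 <= K by apply: le_trans (sK (Ordinal N0)).
apply: (@le_trans _ _ (K * \sum_(n < N) `|Psi n t|)).
  by rewrite mulr_sumr; apply: ler_sum => n _; rewrite normrM ler_wpM2r.
by rewrite ler_wpM2l// Psi_sum_le.
Qed.

Lemma bounded_measurable_segment_integrable (f : R -> R) B :
  measurable_fun I f -> (forall t, I t -> `|f t| <= B) ->
  mu.-integrable I (EFin \o f).
Proof.
move=> mf fB; apply: measurable_bounded_integrable => //.
  exact: lebesgue_segment_lty.
exists B; split; first exact: num_real.
by move=> a Ba x xI; apply: le_trans (ltW Ba); exact: fB.
Qed.

Lemma measurable_Psi_comb (s : 'I_N -> R) :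
  measurable_fun I (fun t => \sum_(n < N) s n * Psi n t).
Proof.
by apply: measurable_sum => n; apply: measurable_funM => //; exact: measurable_Psi.
Qed.

(** The arguments of [q] stay within [q_radius], where [C1norm] is a Lipschitz constant. One factor
    [Psi_sup] comes from the expansion, the other from the test function [Psi m], and [T] is the
    length of the interval. *)
Lemma q_coef_lipschitz (q : R -> R) (M : R) (m : 'I_N) (s s' : 'I_N -> R) :
  C1_fun q -> 0 <= M ->
  (forall n, `|s n| <= M * Num.sqrt T) -> (forall n, `|s' n| <= M * Num.sqrt T) ->
  `|q_coef T Psi q m s - q_coef T Psi q m s'| <=
  C1norm (q_radius N T Psi M) q * Psi_sup ^+ 2 * T * \sum_(n < N) `|s n - s' n|.
Proof.
move=> Cq M0 sM s'M.
set L := C1norm _ _; set D := \sum_(n < N) _.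
have cq : continuous q.
  move=> x; have [dq _] := Cq; apply: differentiable_continuous.
  by apply/derivable1_diffP; exact: dq.
have mq : measurable_fun setT q by exact: continuous_measurable_fun.
pose U (s : 'I_N -> R) t := \sum_(n < N) s n * Psi n t.
have rad s0 t : I t -> (forall n, `|s0 n| <= M * Num.sqrt T) ->
    `|U s0 t| <= q_radius N T Psi M.
  by move=> tI s0M; exact: Psi_comb_le.
(* The time 0 provides a point within the radius, where the derivative bound shows that the norm is
   nonnegative. *)
have L0 : 0 <= L.
  have z : I 0 by rewrite /= in_itv/= lexx ltW.
  exact: le_trans (normr_ge0 _) (C1norm_derive_le _ _ _ _ Cq (rad s 0 z sM)).
have mI (s0 : 'I_N -> R) : measurable_fun I (fun t => q (U s0 t) * Psi m t).
  apply: measurable_funM; last exact: measurable_Psi.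
  by apply: measurableT_comp => //; exact: measurable_Psi_comb.
have [B B0 hB] : exists2 B, 0 <= B & forall x, `|x| <= q_radius N T Psi M -> `|q x| <= B.
  have [B B0 hB] := segment_continuous_bounded _ (- q_radius N T Psi M)
    (q_radius N T Psi M) q (continuous_subspaceT cq).
  by exists B => // x xr; apply: hB; rewrite in_itv/= -ler_norml.
have iI (s0 : 'I_N -> R) : (forall n, `|s0 n| <= M * Num.sqrt T) ->
    mu.-integrable I (EFin \o (fun t => q (U s0 t) * Psi m t)).
  move=> s0M; apply: (bounded_measurable_segment_integrable _ (B * Psi_sup)) => // t tI.
  rewrite normrM; apply: ler_pM => //; [exact/hB/rad|exact: Psi_le].
have is_ := iI _ sM; have is'_ := iI _ s'M.
rewrite /q_coef -RintegralB//.
apply: le_trans (le_normr_Rintegral _ _) _ => //.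
  rewrite (_ : _ \o _ = (EFin \o (fun t => q (U s t) * Psi m t)%R) \-
     (EFin \o (fun t => q (U s' t) * Psi m t)%R))%E; last by apply/funext.
  exact: integrableB.
have bnd t : I t ->
    `|q (U s t) * Psi m t - q (U s' t) * Psi m t| <= L * Psi_sup ^+ 2 * D.
  move=> tI; rewrite -mulrBl normrM.
  apply: (@le_trans _ _ (L * (D * Psi_sup) * Psi_sup)); last by rewrite le_eqVlt; apply/orP; left; apply/eqP; ring.
  apply: ler_pM => //; last exact: Psi_le.
  apply: le_trans (C1norm_lipschitz _ _ _ _ _ Cq (rad s t tI sM) (rad s' t tI s'M)) _.
  rewrite -/L ler_wpM2l//.
  have -> : U s t - U s' t = \sum_(n < N) (s n - s' n) * Psi n t.
    by rewrite /U -sumrB; apply: eq_bigr => n _; rewrite mulrBl.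
  (* Each difference of coefficients is bounded by their sum [D], which serves as the uniform bound
     [K]. *)
  apply: Psi_comb_le => // n; rewrite /D (bigD1 n)//= lerDl; exact: sumr_ge0.
apply: (@le_trans _ _ (\int[mu]_(t in I) (L * Psi_sup ^+ 2 * D))).
  apply: le_Rintegral => //.
  - apply: (bounded_measurable_segment_integrable _ (L * Psi_sup ^+ 2 * D)).
      by apply: measurableT_comp => //; apply: measurable_funB; exact: mI.
    by move=> t tI; rewrite normr_id; exact: bnd.
  - apply: (bounded_measurable_segment_integrable _ `|L * Psi_sup ^+ 2 * D|) => //.
rewrite Rintegral_cst// (_ : fine _ = T); last by rewrite -[RHS]/(fine T%:E) -lebesgue_segment.
by rewrite le_eqVlt; apply/orP; left; apply/eqP; ring.
Qed.

(** Orthonormality gives [s m] as the integral of the expansion against [Psi m], at most [M] times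
    the integral of [|Psi m|]; the latter is at most [sqrt T] because [Psi m] has unit norm. *)
Lemma coefficient_le (M : R) (s : 'I_N -> R) : 0 <= M ->
  {ae mu, forall t, I t -> `|\sum_(n < N) s n * Psi n t| <= M} ->
  forall m, `|s m| <= M * Num.sqrt T.
Proof.
move=> M0 ae m; have [_ ortho _] := oPsi.
pose U t := \sum_(n < N) s n * Psi n t.
have bPP (n k : 'I_N) : mu.-integrable I (EFin \o (fun t => Psi n t * Psi k t)).
  apply: (bounded_measurable_segment_integrable _ (Psi_sup * Psi_sup)).
    by apply: measurable_funM; exact: measurable_Psi.
  by move=> t tI; rewrite normrM; apply: ler_pM => //; exact: Psi_le.
have [iU EU] := RintegralZ_sum _ _ _ mu I _ (index_enum 'I_N) s
  (fun n t => Psi n t * Psi m t) (measurable_itv _) (fun n => bPP n m).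
have E : s m = \int[mu]_(t in I) (U t * Psi m t).
  transitivity (\int[mu]_(t in I) (\sum_(n < N) s n * (Psi n t * Psi m t))); last first.
    by apply: eq_Rintegral => t _; rewrite mulr_suml; apply: eq_bigr => n _; rewrite mulrA.
  rewrite EU (bigD1 m)//= ortho eqxx mulr1 big1 ?addr0// => n nm.
  by rewrite ortho (_ : (_ == _) = false) ?mulr0//; exact/negbTE.
have mU : measurable_fun I U by exact: measurable_Psi_comb.
have iUP : mu.-integrable I (EFin \o (fun t => U t * Psi m t)).
  rewrite (_ : (fun t => _) = fun t => \sum_(n < N) s n * (Psi n t * Psi m t))//.
  by apply/funext => t; rewrite mulr_suml; apply: eq_bigr => n _; rewrite mulrA.
have iP : mu.-integrable I (EFin \o (fun t => `|Psi m t|)).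
  apply: (bounded_measurable_segment_integrable _ Psi_sup).
    by apply: measurableT_comp => //; exact: measurable_Psi.
  by move=> t tI; rewrite normr_id; exact: Psi_le.
have iMP : mu.-integrable I (EFin \o (fun t => M * `|Psi m t|)).
  exact: (@integrableZl _ _ _ mu _ (measurable_itv _) M _ iP).
rewrite E; apply: (le_trans (le_normr_Rintegral _ iUP)) => //.
apply: (@le_trans _ _ (\int[mu]_(t in I) (M * `|Psi m t|))).
  (* The bound on the expansion holds only almost everywhere, so the comparison passes through
     extended-real integrals. *)
  rewrite /Rintegral fine_le//.
  - apply: integrable_fin_num => //.
    by apply/integrable_norm.
  - exact: integrable_fin_num.
  - apply: ae_ge0_le_integral => //.
    + apply/measurable_EFinP; apply: measurableT_comp => //.
      by case/integrableP: iUP => /measurable_EFinP.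
    + by move=> t _; rewrite lee_fin mulr_ge0.
    + by case/integrableP: iMP.
    + case: ae => A [mA A0 sA]; exists A; split => // t nt; apply: sA => /= h.
      by apply: nt => tI; rewrite /= lee_fin normrM ler_wpM2r//; exact: h.
rewrite RintegralZl// ler_wpM2l//.
(* AM-GM: [2 |Psi| <= sqrt T * Psi ^ 2 + 1 / sqrt T] *)
have S0 : 0 < Num.sqrt T by rewrite sqrtr_gt0.
have iPP := bPP m m.
have iZ : mu.-integrable I (EFin \o (fun t => Num.sqrt T / 2 * (Psi m t * Psi m t))).
  exact: (@integrableZl _ _ _ mu _ (measurable_itv _) (Num.sqrt T / 2) _ iPP).
have iC : mu.-integrable I (EFin \o (cst (2 * Num.sqrt T)^-1)).
  exact: (bounded_measurable_segment_integrable _ `|(2 * Num.sqrt T)^-1|).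
apply: (@le_trans _ _ (\int[mu]_(t in I)
  (Num.sqrt T / 2 * (Psi m t * Psi m t) + cst (2 * Num.sqrt T)^-1 t))).
  apply: le_Rintegral => //.
    rewrite (_ : _ \o _ = (EFin \o (fun t => Num.sqrt T / 2 * (Psi m t * Psi m t))%R) \+
     (EFin \o cst (2 * Num.sqrt T)^-1%R))%E; last by apply/funext.
    exact: integrableD.
  move=> t _ /=; rewrite -expr2 -(real_normK (num_real (Psi m t))).
  rewrite -subr_ge0 (_ : _ - _ = (2 * Num.sqrt T)^-1 * (Num.sqrt T * `|Psi m t| - 1) ^+ 2).
    by rewrite mulr_ge0 ?sqr_ge0// invr_ge0 mulr_ge0// ltW.
  by field; rewrite gt_eqF.
rewrite RintegralD// RintegralZl// ortho eqxx mulr1 Rintegral_cst//.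
rewrite (_ : fine _ = T); last by rewrite -[RHS]/(fine T%:E) -lebesgue_segment.
(* What remains is [sqrt T / 2 + T / (2 sqrt T) <= sqrt T]; with [a = sqrt T] and [T = a ^ 2] it is
   an identity of fractions. *)
have E2 := sqr_sqrtr (ltW T0); move: (Num.sqrt T) S0 E2 => a a0 E2.
rewrite -[X in _ + _ * X]E2 le_eqVlt; apply/orP; left; apply/eqP.
by field; rewrite gt_eqF.
Qed.

End coefficients.

(** The product measure of the exceptional set is the integral of the measures of its sections; it
    vanishes, so almost every section is null. *)
Lemma ae_product_section d1 d2 (X : measurableType d1) (Y : measurableType d2)
    (R : realType) (m1 : {measure set X -> \bar R})
    (m2 : {sigma_finite_measure set Y -> \bar R}) (P : X * Y -> Prop) :
  {ae (m1 \x m2)%E, forall z, P z} ->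
  {ae m1, forall x, {ae m2, forall y, P (x, y)}}.
Proof.
move=> [A [mA A0 sA]].
have mphi : measurable_fun setT (m2 \o xsection A).
  exact: measurable_fun_xsection.
have /(ae_eq_integral_abs m1 measurableT mphi) h :
    (\int[m1]_x `|(m2 \o xsection A) x| = 0)%E.
  rewrite -[RHS]A0; apply: eq_integral => x _.
  by rewrite gee0_abs// measure_ge0.
case: h => B [mB B0 sB]; exists B; split => // x nx; apply: sB => /= h.
apply: nx => /=; exists (xsection A x); split.
- exact: measurable_xsection.
- exact: h.
- by move=> y ny; rewrite /xsection /= inE; apply: sA.
Qed.

(** * Bounds and measurability of the coefficient functions *)

Section coefficient_bound.
Context (R : realType) (d N : nat) (T : R) (Psi : nat -> R -> R).
Hypotheses (T0 : 0 < T) (oPsi : orthonormal_basis T Psi).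
Hypothesis cPsi : forall n, C1_segment 0 T (Psi n).
Local Notation leb := (lebesgue_rV R d).

Lemma Linfty_coefficient_le (Omega : set 'rV[R]_d) (M : R) (u : 'I_N -> 'rV[R]_d -> R) :
  0 <= M -> (Linfty_norm T Omega (expansion Psi u) < M%:E)%E ->
  {ae leb, forall x, Omega x -> forall m, `|u m x| <= M * Num.sqrt T}.
Proof.
move=> M0 hM.
have : {ae (leb \x lebesgue_measure)%E, forall z : 'rV[R]_d * R,
    Omega z.1 -> `[0, T]%classic z.2 -> `|expansion Psi u z.1 z.2| <= M}.
  (* The norm at infinity is an essential supremum when the space has positive measure and 0
     otherwise; in the second case every property holds almost everywhere. *)
  move: hM; rewrite /Linfty_norm unlock; case: ifPn => [_ hM|h0 _].
    have /ess_supP := ltW hM; apply: filterS => -[x t] /= h Ox tI.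
    by move: h; rewrite patchE mem_set ?lee_fin.
  apply: measure0_ae; apply/eqP; rewrite -measure_le0 leNgt; exact: h0.
move=> /ae_product_section; apply: filterS => x h Ox.
apply: (coefficient_le _ _ _ _ T0 oPsi cPsi) => //.
case: h => A [mA A0 sA]; exists A; split => // t nt; apply: sA => /= h.
by apply: nt => tI; exact: h.
Qed.

(** By the Lipschitz estimate, [q_coef] after the cut-off is continuous in the vector of values, and
    it is composed with a measurable vector function. *)
Lemma measurable_q_coef_cutoff (D : set 'rV[R]_d) (q : R -> R) (M : R) (m : 'I_N)
    (u : 'I_N -> 'rV[R]_d -> R) : C1_fun q -> 0 <= M -> measurable D ->
  (forall n, measurable_fun D (u n)) ->
  measurable_fun D (fun x => q_coef T Psi q m (fun n => cutoff T M (u n x))).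
Proof.
move=> Cq M0 mD mu.
pose G (s : 'rV[R]_N) := q_coef T Psi q m (fun n => cutoff T M (s ord0 n)).
have cG : continuous G.
  move=> s; apply/(@cvgrPdist_lt _ _ _ (nbhs s) (nbhs_filter s)) => e e0.
  set K := `|C1norm (q_radius N T Psi M) q * Psi_sup R T Psi N ^+ 2 * T|.
  have K0 : 0 <= K by exact: normr_ge0.
  (* The [+ 1] keeps the denominator of the continuity modulus positive when [K] or [N] is 0. *)
  have KN : 0 < K * N%:R + 1 by rewrite ltr_wpDl// mulr_ge0.
  apply/nbhs_ballP; exists (e / (K * N%:R + 1)) => /=; first by rewrite divr_gt0.
  move=> s' [_ /(_ ord0) ss'].
  apply: le_lt_trans (q_coef_lipschitz _ _ _ _ T0 cPsi q M m _ _ Cq M0 _ _) _.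
  - by move=> n; exact: cutoff_le.
  - by move=> n; exact: cutoff_le.
  apply: (@le_lt_trans _ _ (K * (N%:R * (e / (K * N%:R + 1))))).
    apply: (@le_trans _ _ (K *
        \sum_(n < N) `|cutoff T M (s ord0 n) - cutoff T M (s' ord0 n)|)).
      by rewrite ler_wpM2r ?sumr_ge0//; exact: ler_norm.
    rewrite ler_wpM2l// -[X in X%:R * _](card_ord N) -sum1_card natr_sum mulr_suml.
    apply: ler_sum => n _; rewrite mul1r.
    by apply: le_trans (cutoff_lipschitz _ _ _ _ _) _; exact/ltW/ss'.
  rewrite (_ : K * _ = e * (K * N%:R / (K * N%:R + 1))); last by ring.
  rewrite -[ltRHS]mulr1 ltr_pM2l// ltr_pdivrMr// mul1r.
  by rewrite ltrDl.
(* The [u n] are measurable on [D] only, so they are extended by 0 before being assembled into a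
   vector. *)
apply: (@eq_measurable_fun _ _ _ _ _ (G \o (fun x => \row_n (u n \_ D) x))).
  move=> x xD; rewrite /G /=; congr q_coef; apply/funext => n.
  by rewrite mxE patchE xD.
apply: measurable_funTS; apply: measurableT_comp.
  exact: continuous_measurable_rV.
apply: measurable_fun_coordP => n.
under eq_fun do rewrite mxE.
exact: (iffLR (measurable_restrictT (u n) mD) (mu n)).
Qed.

End coefficient_bound.

(** * The weight and the parallelogram law *)

(** Cauchy-Schwarz against the constant 1, by induction on the list: after multiplication by the
    length [k > 0], the cross term completes to the square [(k a_i - S) ^ 2]. *)
Lemma sqr_sum_le (R : realFieldType) (I : Type) (r : seq I) (a : I -> R) :
  (\sum_(i <- r) a i) ^+ 2 <= (size r)%:R * \sum_(i <- r) a i ^+ 2.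
Proof.
elim: r => [|i r IH]; first by rewrite !big_nil expr0n mul0r.
rewrite !big_cons /=; move: IH; rewrite -natr1.
set S := \sum_(_ <- _) _; set Q := \sum_(_ <- _) _.
have Q0 : 0 <= Q by apply: sumr_ge0 => j _; exact: sqr_ge0.
have [-> IH|k0 IH] := posnP (size r).
  have S0 : S = 0 by apply/eqP; rewrite -sqrf_eq0 eq_le sqr_ge0 andbT; move: IH; rewrite mul0r.
  by rewrite S0; lra.
have : (0 : R) < (size r)%:R by rewrite ltr0n.
move: (size r)%:R IH => k IH {}k0; rewrite -subr_ge0.
have -> : (k + 1) * (a i ^+ 2 + Q) - (a i + S) ^+ 2 =
  (k * Q - S ^+ 2) + (k * a i ^+ 2 + Q - 2 * a i * S) by ring.
apply: addr_ge0; first by rewrite subr_ge0.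
rewrite -(pmulr_rge0 _ k0).
have -> : k * (k * a i ^+ 2 + Q - 2 * a i * S) =
  (k * a i - S) ^+ 2 + (k * Q - S ^+ 2) by ring.
by rewrite addr_ge0 ?sqr_ge0// subr_ge0.
Qed.

Lemma sqr_sum_mul_le (R : realFieldType) N (s h : 'I_N -> R) :
  (\sum_(n < N) s n * h n) ^+ 2 <= N%:R * (\sum_(n < N) s n ^+ 2) * \sum_(n < N) h n ^+ 2.
Proof.
apply: le_trans (sqr_sum_le _ _ _ _) _.
rewrite [size _](_ : _ = N); last by rewrite -[RHS]card_ord cardT enumT.
rewrite -mulrA ler_wpM2l//.
rewrite mulr_sumr; apply: ler_sum => n _; rewrite exprMn ler_wpM2r ?sqr_ge0//.
by rewrite (bigD1 n)//= lerDl sumr_ge0// => k _; exact: sqr_ge0.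
Qed.

Section weight.
Context (R : realType) (d : nat) (x0 : 'rV[R]_d) (b beta : R).
Local Notation w := (weight x0 b beta).

Lemma weight_gt0 lambda x : 0 < w lambda x.
Proof. exact: expR_gt0. Qed.

(** Turns the doubled parameter in [J] and in the Carleman estimate into squares of functions
    multiplied by [w lambda]. *)
Lemma weight_sqr lambda x : w (2 * lambda) x = w lambda x ^+ 2.
Proof. by rewrite /weight expr2 -expRD; congr expR; ring. Qed.

Lemma weight_ge1 lambda x : 0 <= lambda -> 1 <= w lambda x.
Proof. by move=> l0; rewrite -expR0 ler_expR !mulr_ge0// powR_ge0. Qed.

Lemma measurable_weight lambda : measurable_fun setT (w lambda).
Proof.
apply: measurableT_comp => //; apply: measurable_funM => //.
apply: (@measurableT_comp _ _ _ _ _ _ (fun x => x `^ beta)) => //.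
apply: (@measurableT_comp _ _ _ _ _ _ (@Num.sqrt R)) => //.
  by apply: continuous_measurable_fun; exact: sqrt_continuous.
apply: measurable_sum => i; apply: measurable_funX.
under eq_fun do rewrite !mxE.
by apply: measurable_funB => //; exact: measurable_coord.
Qed.

Lemma weight_le lambda x : 0 <= lambda -> 0 <= beta -> rdist x0 x <= b ->
  w lambda x <= expR (lambda * b `^ (- beta) * b `^ beta).
Proof.
move=> l0 beta0 xb; have r0 : 0 <= rdist x0 x by exact: sqrtr_ge0.
rewrite ler_expR ler_wpM2l ?mulr_ge0 ?powR_ge0//.
by rewrite ge0_ler_powR// nnegrE// (le_trans r0).
Qed.

End weight.

Section midpoint.
Context d (X : measurableType d) (R : realType).
Variable mu : {measure set X -> \bar R}.
Variables (D : set X) (mD : measurable D).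
Local Open Scope ereal_scope.

Lemma integral_sum_EFin N (F : 'I_N -> X -> R) :
  (forall m, measurable_fun D (F m)) -> (forall m x, D x -> (0 <= F m x)%R) ->
  \sum_(m < N) \int[mu]_(x in D) (F m x)%:E =
  \int[mu]_(x in D) (\sum_(m < N) F m x)%:E.
Proof.
move=> mF F0; rewrite -ge0_integral_sum//.
- by apply: eq_integral => x _; rewrite sumEFin.
- by move=> n; apply/measurable_EFinP; exact: mF.
Qed.

(** Parallelogram law: [a] is the squared norm of the minimizer, [e] of the
    competitor, [m] of their midpoint and [f] of their difference. *)
Lemma midpoint_minimizer (a e m f : X -> R) :
  measurable_fun D a -> measurable_fun D e -> measurable_fun D m -> measurable_fun D f ->
  (forall x, (0 <= a x)%R) -> (forall x, (0 <= e x)%R) -> (forall x, (0 <= m x)%R) ->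
  (forall x, (0 <= f x)%R) -> (forall x, m x + f x / 4 = (a x + e x) / 2)%R ->
  \int[mu]_(x in D) (a x)%:E <= \int[mu]_(x in D) (m x)%:E ->
  \int[mu]_(x in D) (a x)%:E <= \int[mu]_(x in D) (e x)%:E ->
  \int[mu]_(x in D) (f x)%:E <= 2%:E * \int[mu]_(x in D) (e x)%:E.
Proof.
move=> ma me mm mf a0 e0 m0 f0 h am ae.
have E : \int[mu]_(x in D) (m x)%:E + (4^-1)%:E * \int[mu]_(x in D) (f x)%:E =
    (2^-1)%:E * \int[mu]_(x in D) (a x)%:E + (2^-1)%:E * \int[mu]_(x in D) (e x)%:E.
  rewrite -!ge0_integralZl//; try (by exact/measurable_EFinP); try (by move=> x _; rewrite lee_fin);
    try (by rewrite lee_fin invr_ge0).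
  rewrite -!ge0_integralD//; try (by move=> x _; rewrite -?EFinM lee_fin ?mulr_ge0 ?invr_ge0);
   try (by apply/measurable_EFinP => //; exact: measurable_funM).
  by apply: eq_integral => x _; rewrite -!EFinM -!EFinD; congr EFin; have := h x; lra.
have I0 (g : X -> R) : (forall x, (0 <= g x)%R) -> 0 <= \int[mu]_(x in D) (g x)%:E.
  by move=> g0; apply: integral_ge0 => x _; rewrite lee_fin.
(* The four integrals become abstract extended reals. If that of [e] is infinite the claim is
   trivial; otherwise all are finite, and [f <= 2 (a + e) - 4 m <= 2 e - 2 a <= 2 e]. *)
move: (I0 a a0) (I0 e e0) (I0 m m0) (I0 f f0) am ae E.
move: (\int[mu]_(x in D) (a x)%:E) (\int[mu]_(x in D) (e x)%:E)
  (\int[mu]_(x in D) (m x)%:E) (\int[mu]_(x in D) (f x)%:E).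
move=> A G B F A0 G0 B0 F0 AB AG E.
case: G G0 AG E => [G||//] G0 AG E; last by rewrite mulry gtr0_sg// mul1e leey.
case: A A0 AB AG E => [A||//] A0 AB AG E; last by move: AG; rewrite leye_eq.
case: B B0 AB E => [B||//] B0 AB E; last first.
  by case: F F0 E => [F||//] F0 //=; rewrite mulry gtr0_sg ?invr_gt0// mul1e.
case: F F0 E => [F||//] F0; last by rewrite mulry gtr0_sg ?invr_gt0// mul1e.
by move: A0 AB => + + [] E; rewrite -EFinM !lee_fin; lra.
Qed.

End midpoint.

(** * The functional and its minimizers *)

Section H2_measurable.
Context (R : realType) (d : nat) (Omega : set 'rV[R]_d) (mO : measurable Omega).

Lemma measurable_H2 (u : H2 Omega) : measurable_fun Omega u.
Proof. exact: inL2_measurable_in mO (H2val_L2 u). Qed.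

Lemma measurable_laplacian (u : H2 Omega) : measurable_fun Omega (laplacian u).
Proof.
by apply: measurable_sum => i; exact: inL2_measurable_in mO (whess_L2 u i i).
Qed.

End H2_measurable.

Section contraction.
Context (R : realType) (d N : nat) (T : R) (Omega : set 'rV[R]_d)
    (c : 'rV[R]_d -> R) (Psi : nat -> R -> R) (x0 : 'rV[R]_d) (b beta : R).
Hypotheses (mO : measurable Omega) (bO : bounded_set Omega) (cc : continuous c).
Local Notation leb := (lebesgue_rV R d).
Local Notation w := (weight x0 b beta).

Lemma measurable_weight_in lambda : measurable_fun Omega (w lambda).
Proof. by apply: measurable_funTS; exact: measurable_weight. Qed.

(** Only the zero-order term of the Carleman estimate is kept; the Hessian and gradient terms are
    nonnegative and dropped. *)
Lemma carleman_L2 (C' lambda : R) (v : H2 Omega) : 0 < C' -> 0 < lambda ->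
  (C'%:E * \int[leb]_(x in Omega)
       (weight x0 b beta (2 * lambda) x *
        (lambda^-1 * (\sum_(i < d) \sum_(j < d) `|whess v i j x| ^+ 2)
         + lambda * (\sum_(i < d) `|wgrad v i x| ^+ 2)
         + lambda ^+ 3 * `|v x| ^+ 2))%:E
     <= \int[leb]_(x in Omega)
       (weight x0 b beta (2 * lambda) x * `|laplacian v x| ^+ 2)%:E)%E ->
  ((C' * lambda ^+ 3)%:E * \int[leb]_(x in Omega) ((w lambda x * v x) ^+ 2)%:E <=
   \int[leb]_(x in Omega) ((w lambda x * laplacian v x) ^+ 2)%:E)%E.
Proof.
move=> C0 l0.
have mw := measurable_weight_in lambda.
have -> : (\int[leb]_(x in Omega) (w (2 * lambda) x * `|laplacian v x| ^+ 2)%:E =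
  \int[leb]_(x in Omega) ((w lambda x * laplacian v x) ^+ 2)%:E)%E.
  by apply: eq_integral => x _; rewrite weight_sqr real_normK ?num_real// exprMn.
apply: le_trans; rewrite EFinM -muleA lee_pmul2l//.
rewrite -ge0_integralZl//; last 3 first.
- apply/measurable_EFinP; apply: measurable_funX; apply: measurable_funM => //.
  exact: measurable_H2.
- by move=> x _; rewrite lee_fin sqr_ge0.
- by rewrite lee_fin exprn_ge0// ltW.
apply: ge0_le_integral => //.
- by move=> x _; rewrite -EFinM lee_fin mulr_ge0 ?sqr_ge0// exprn_ge0// ltW.
- apply/measurable_EFinP; apply: measurable_funM => //; apply: measurable_funX.
  by apply: measurable_funM => //; exact: measurable_H2.
- apply/measurable_EFinP; apply: measurable_funM; first exact: measurable_weight_in.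
  apply: measurable_funD; first apply: measurable_funD.
  + apply: measurable_funM => //; apply: measurable_sum => i; apply: measurable_sum => j.
    apply: measurable_funX; apply: measurableT_comp => //.
    exact: inL2_measurable_in mO (whess_L2 v i j).
  + apply: measurable_funM => //; apply: measurable_sum => i.
    apply: measurable_funX; apply: measurableT_comp => //.
    exact: inL2_measurable_in mO (wgrad_L2 v i).
  + apply: measurable_funM => //; apply: measurable_funX; apply: measurableT_comp => //.
    exact: measurable_H2.
- move=> x _; rewrite -EFinM lee_fin weight_sqr exprMn mulrCA ler_wpM2l ?sqr_ge0//.
  rewrite -(real_normK (num_real (v x))) lerDr addr_ge0// mulr_ge0 ?invr_ge0 ?(ltW l0)//.
    by do 2 (apply: sumr_ge0 => ? _); rewrite exprn_ge0.
  by apply: sumr_ge0 => ? _; rewrite exprn_ge0.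
Qed.

(** The expression squared in [J]: affine in [u], with [residual (fun _ _ => 0)] as its linear
    part. *)
Definition residual (F : 'I_N -> 'rV[R]_d -> R) (u : 'I_N -> H2 Omega) m x :=
  laplacian (u m) x - c x * (\sum_(n < N) s_coef T Psi m n * u n x) + F m x.

Definition weighted_sqr (lambda : R) (h : 'I_N -> 'rV[R]_d -> R) x :=
  \sum_(m < N) (w lambda x * h m x) ^+ 2.

Lemma weighted_sqr_ge0 lambda h x : 0 <= weighted_sqr lambda h x.
Proof. by apply: sumr_ge0 => m _; exact: sqr_ge0. Qed.

Lemma measurable_weighted_sqr lambda h : (forall m, measurable_fun Omega (h m)) ->
  measurable_fun Omega (weighted_sqr lambda h).
Proof.
move=> mh; apply: measurable_sum => m; apply: measurable_funX.
by apply: measurable_funM => //; exact: measurable_weight_in.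
Qed.

Lemma sum_integral_weighted lambda h : (forall m, measurable_fun Omega (h m)) ->
  (\sum_(m < N) \int[leb]_(x in Omega) ((w lambda x * h m x) ^+ 2)%:E =
   \int[leb]_(x in Omega) (weighted_sqr lambda h x)%:E)%E.
Proof.
move=> mh.
apply: (integral_sum_EFin _ _ _ leb _ mO _ (fun m x => (w lambda x * h m x) ^+ 2)).
- move=> m; apply: measurable_funX.
  by apply: measurable_funM => //; exact: measurable_weight_in.
- by move=> m x _; exact: sqr_ge0.
Qed.

Lemma measurable_residual F u m : (forall m, measurable_fun Omega (F m)) ->
  measurable_fun Omega (residual F u m).
Proof.
move=> mF; apply: measurable_funD => //; apply: measurable_funB.
  exact: measurable_laplacian.
apply: measurable_funM.
  by apply: measurable_funTS; exact: continuous_measurable_rV.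
by apply: measurable_sum => n; apply: measurable_funM => //; exact: measurable_H2.
Qed.

Lemma J_residual lambda F u : (forall m, measurable_fun Omega (F m)) ->
  J T Psi c x0 b beta lambda F u =
  (\int[leb]_(x in Omega) (weighted_sqr lambda (residual F u) x)%:E)%E.
Proof.
move=> mF; rewrite -sum_integral_weighted; last by move=> m; exact: measurable_residual.
apply: eq_bigr => m _; apply: eq_integral => x _.
by rewrite weight_sqr real_normK ?num_real// exprMn.
Qed.

Definition H2_diff (u v : 'I_N -> H2 Omega) m := H2_linear _ _ _ mO bO 1 (-1) (u m) (v m).

(** The minimality of [u] is tested against [v] and the midpoint of [u] and
    [v], both admissible. *)
Lemma minimizer_residual_le (lambda : R) f g F (u v : 'I_N -> H2 Omega) :
  (forall m, measurable_fun Omega (F m)) ->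
  is_minimizer (admissible f g) (J T Psi c x0 b beta lambda F) u ->
  admissible f g v ->
  (\int[leb]_(x in Omega)
     (weighted_sqr lambda (residual (fun _ _ => 0%R) (H2_diff u v)) x)%:E <=
   2%:E * \int[leb]_(x in Omega) (weighted_sqr lambda (residual F v) x)%:E)%E.
Proof.
move=> mF [Au minu] Av.
have mr F' z m : (forall m, measurable_fun Omega (F' m)) ->
  measurable_fun Omega (residual F' z m) by exact: measurable_residual.
pose z m := H2_linear _ _ _ mO bO 2^-1 2^-1 (u m) (v m).
have Az : admissible f g z.
  move=> m; have [ut un] := Au m; have [vt vn] := Av m.
  have half (k : 'rV[R]_d -> R) : (fun x => 2^-1 * k x + 2^-1 * k x) = k.
    by apply/funext => x; field.
  split.
    by rewrite -(half (f m)); exact: has_trace_linear.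
  by rewrite -(half (g m)); exact: has_normal_trace_linear.
apply: (midpoint_minimizer _ _ _ leb _ mO (weighted_sqr lambda (residual F u))
  (weighted_sqr lambda (residual F v)) (weighted_sqr lambda (residual F z)));
  try (by apply: measurable_weighted_sqr => m; exact: mr);
  try (by move=> x; exact: weighted_sqr_ge0).
(* The residual of the midpoint is the mean of the two residuals, and the linear part at [u - v] is
   their difference; the parallelogram identity then holds for each [m]. *)
- move=> x; rewrite /weighted_sqr !mulr_suml -!big_split/= mulr_suml.
  apply: eq_bigr => m _.
  have -> : residual F z m x = 2^-1 * (residual F u m x + residual F v m x).
    rewrite /residual laplacian_linear /=.
    have -> : \sum_(n < N) s_coef T Psi m n * (2^-1 * u n x + 2^-1 * v n x) =
      2^-1 * (\sum_(n < N) s_coef T Psi m n * u n x) +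
      2^-1 * (\sum_(n < N) s_coef T Psi m n * v n x).
      by rewrite !mulr_sumr -big_split; apply: eq_bigr => n _ /=; ring.
    by field.
  have -> : residual (fun _ _ => 0) (H2_diff u v) m x = residual F u m x - residual F v m x.
    rewrite /residual laplacian_linear /=.
    have -> : \sum_(n < N) s_coef T Psi m n * (1 * u n x + -1 * v n x) =
      (\sum_(n < N) s_coef T Psi m n * u n x) -
      (\sum_(n < N) s_coef T Psi m n * v n x).
      by rewrite -sumrB; apply: eq_bigr => n _ /=; ring.
    by ring.
  by field.
- by rewrite -!J_residual//; exact: minu.
- by rewrite -!J_residual//; exact: minu.
Qed.

End contraction.

(** [E] is the new error, [Y] the old one, [A] the linear operator applied to the new error and [D]
    the residual of the exact solution. As [E] is finite, [K E <= l E / 2] can be subtracted,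
    leaving [l E / 2 <= 2 A <= 4 D <= 4 L Y], whence the 8. *)
Lemma ereal_absorb (R : realType) (E A D Y : \bar R) (L K l : R) :
  (D <= L%:E * Y)%E -> 0 < l -> 0 <= L -> 2 * K <= l ->
  (A <= 2%:E * D)%E -> (l%:E * E <= 2%:E * A + K%:E * E)%E ->
  (0 <= E)%E -> (E < +oo)%E -> (0 <= Y)%E -> (0 <= A)%E ->
  (E <= (8 * L / l)%:E * Y)%E.
Proof.
move=> hD l0 L0 hl hA hE E0 Eoo Y0 A0.
have -> : ((8 * L / l)%:E * Y = (8 / l)%:E * (L%:E * Y))%E.
  by rewrite muleA -EFinM; congr (_%:E * _)%E; ring.
have Z0 : (0 <= L%:E * Y)%E by rewrite mule_ge0.
move: (L%:E * Y)%E Z0 hD => Z Z0 hD.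
have c0 : 0 < 8 / l by rewrite divr_gt0.
case: Z Z0 hD => [Z||//] Z0 hD; last by rewrite mulry gtr0_sg// mul1e leey.
case: D hD hA => [D|//|] hD hA; last first.
  by move: hA; rewrite mulrNy gtr0_sg// mul1e leeNy_eq => /eqP AE; rewrite AE in A0.
case: A A0 hA hE => [A|//|//] A0 hA hE.
case: E E0 Eoo hE => [E|//|//] E0 _.
move: A0 E0 Z0 hD hA; rewrite -!EFinM -EFinD !lee_fin => A0 E0 Z0 hD hA hE.
rewrite mulrAC ler_pdivlMr//.
have : K * E <= l / 2 * E by apply: ler_wpM2r => //; lra.
by lra.
Qed.

(** * One step of the iteration *)

Section step.
Context (R : realType) (d N : nat) (T : R) (Omega : set 'rV[R]_d)
    (c : 'rV[R]_d -> R) (Psi : nat -> R -> R) (x0 : 'rV[R]_d) (b beta : R).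
Hypotheses (mO : measurable Omega) (bO : bounded_set Omega) (cc : continuous c).
Hypothesis T0 : 0 < T.
Hypothesis cPsi : forall n, C1_segment 0 T (Psi n).
Hypotheses (hb : forall x, Omega x -> rdist x0 x <= b) (beta0 : 0 <= beta).
Local Notation leb := (lebesgue_rV R d).
Local Notation w := (weight x0 b beta).
Local Notation wsq := (weighted_sqr R d N x0 b beta).
Local Notation res := (residual R d N T Omega c Psi).

(** Since [r <= b] on [Omega] and [beta >= 0], the weight is bounded there for fixed [lambda]. *)
Lemma inL2_weight (lambda : R) f : 0 <= lambda -> inL2 leb Omega f ->
  inL2 leb Omega (fun x => w lambda x * f x).
Proof.
move=> l0 hf; have mf := inL2_measurable_in _ _ _ _ _ _ mO hf.
have mwf : measurable_fun Omega (fun x => w lambda x * f x).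
  by apply: measurable_funM => //; exact: measurable_weight_in.
apply: integral_inL2 => //.
pose W := expR (lambda * b `^ (- beta) * b `^ beta).
apply: (@le_lt_trans _ _ (\int[leb]_(x in Omega) ((W ^+ 2)%:E * (f x ^+ 2)%:E))%E).
  apply: ge0_le_integral => //.
  - by move=> x _; rewrite lee_fin sqr_ge0.
  - by apply/measurable_EFinP; exact: measurable_funX.
  - by apply/measurable_EFinP; apply: measurable_funM => //; exact: measurable_funX.
  - move=> x Ox; rewrite -EFinM lee_fin exprMn ler_wpM2r ?sqr_ge0// ler_sqr ?nnegrE.
    + by apply: weight_le => //; exact: hb.
    + exact: ltW (weight_gt0 _ _ _ _ _ _ _).
    + exact: expR_ge0.
rewrite ge0_integralZl//.
- by rewrite lte_mul_pinfty ?lee_fin ?sqr_ge0// inL2_integral_lty.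
- by apply/measurable_EFinP; exact: measurable_funX.
- by move=> x _; rewrite lee_fin sqr_ge0.
- by rewrite lee_fin sqr_ge0.
Qed.

Lemma weighted_sqr_lty (lambda : R) (h : 'I_N -> 'rV[R]_d -> R) : 0 <= lambda ->
  (forall m, inL2 leb Omega (h m)) ->
  (\int[leb]_(x in Omega) (wsq lambda h x)%:E < +oo)%E.
Proof.
move=> l0 hh; rewrite -sum_integral_weighted//; last first.
  by move=> m; exact: inL2_measurable_in mO (hh m).
apply: lte_sum_pinfty => m _; apply: inL2_integral_lty => //.
exact: inL2_weight.
Qed.

(** The squared Frobenius norm of the matrix [s_mn]. *)
Definition s_norm2 := \sum_(m < N) \sum_(n < N) s_coef T Psi m n ^+ 2.

(** The Laplacian is the linear operator plus [c] times the coupling sum;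
    [(r + t) ^ 2 <= 2 r ^ 2 + 2 t ^ 2] separates them, and Cauchy-Schwarz bounds the coupling. *)
Lemma residual_coercive (lambda B : R) (h : 'I_N -> H2 Omega) x : `|c x| <= B ->
  \sum_(m < N) (w lambda x * laplacian (h m) x) ^+ 2 <=
  2 * wsq lambda (res (fun _ _ => 0) h) x +
  2 * (B ^+ 2 * N%:R * s_norm2) * wsq lambda (fun m => h m) x.
Proof.
move=> cB.
have -> : wsq lambda (fun m => h m) x = w lambda x ^+ 2 * \sum_(n < N) h n x ^+ 2.
  by rewrite mulr_sumr; apply: eq_bigr => n _; rewrite exprMn.
set H := \sum_(n < N) h n x ^+ 2.
have H0 : 0 <= H by apply: sumr_ge0 => n _; exact: sqr_ge0.
pose S m := \sum_(n < N) s_coef T Psi m n * h n x.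
have -> : 2 * (B ^+ 2 * N%:R * s_norm2) * (w lambda x ^+ 2 * H) =
  \sum_(m < N) 2 * (w lambda x ^+ 2 * (B ^+ 2 * (N%:R * (\sum_(n < N) s_coef T Psi m n ^+ 2) * H))).
  have key (sigma : 'I_N -> R) (k a e : R) : 2 * (B ^+ 2 * k * \sum_(m < N) sigma m) * (a * e) =
      \sum_(m < N) 2 * (a * (B ^+ 2 * (k * sigma m * e))).
    by rewrite !mulr_sumr mulr_suml; apply: eq_bigr => m _; ring.
  exact: key.
rewrite /weighted_sqr mulr_sumr -big_split/=; apply: ler_sum => m _.
have hS : (c x * S m) ^+ 2 <= B ^+ 2 * (N%:R * (\sum_(n < N) s_coef T Psi m n ^+ 2) * H).
  rewrite exprMn; apply: ler_pM; rewrite ?sqr_ge0//; last exact: sqr_sum_mul_le.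
  by rewrite -(real_normK (num_real (c x))) ler_sqr ?nnegrE// (le_trans _ cB).
have E : laplacian (h m) x = res (fun _ _ => 0) h m x + c x * S m.
  by rewrite /residual addr0 subrK.
have := ler_wpM2l (sqr_ge0 (w lambda x)) hS.
move: (_ * (B ^+ 2 * _)) => Z hZ.
rewrite E !exprMn; move: (res _ _ _ _) (c x * S m) hZ => r t hZ.
apply: (@le_trans _ _ (2 * (w lambda x ^+ 2 * r ^+ 2) + 2 * (w lambda x ^+ 2 * t ^+ 2))).
  have := mulr_ge0 (sqr_ge0 (w lambda x)) (sqr_ge0 (r - t)); lra.
by lra.
Qed.

(** The equation for [v] reduces the residual to the difference of [q_coef] at the cut-off values of
    [y] and of [v]. Of the two factors [N], one comes from squaring a sum of [N] terms and one from
    summing over [m]. *)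
Lemma data_error_le (lambda : R) (q : R -> R) (M : R) (y : 'I_N -> 'rV[R]_d -> R) (v : 'I_N -> H2 Omega) :
  0 <= M -> C1_fun q -> (forall m, measurable_fun Omega (y m)) ->
  solves T Psi c q v ->
  {ae leb, forall x, Omega x -> forall m, `|v m x| <= M * Num.sqrt T} ->
  (\int[leb]_(x in Omega) (wsq lambda
      (res (fun m x => q_coef T Psi q m (fun n => cutoff T M (y n x))) v) x)%:E <=
   ((N%:R * (C1norm (q_radius N T Psi M) q * Psi_sup R T Psi N ^+ 2 * T)) ^+ 2)%:E *
   \int[leb]_(x in Omega) (wsq lambda (fun m x => y m x - v m x)%R x)%:E)%E.
Proof.
move=> M0 Cq my sol vM.
set L := C1norm _ _ * _ * _.
have myv m : measurable_fun Omega (fun x => y m x - v m x).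
  by apply: measurable_funB => //; exact: measurable_H2.
rewrite -ge0_integralZl//; last 3 first.
- by apply/measurable_EFinP; exact: measurable_weighted_sqr.
- by move=> x _; rewrite lee_fin weighted_sqr_ge0.
- by rewrite lee_fin sqr_ge0.
apply: ae_ge0_le_integral => //.
- by move=> x _; rewrite lee_fin weighted_sqr_ge0.
- apply/measurable_EFinP; apply: measurable_weighted_sqr => // m.
  by apply: measurable_residual => // n; exact: measurable_q_coef_cutoff.
- by move=> x _; rewrite -EFinM lee_fin mulr_ge0 ?sqr_ge0 ?weighted_sqr_ge0.
- apply/measurable_EFinP; apply: measurable_funM => //.
  exact: measurable_weighted_sqr.
(* There are finitely many [m], so a single null set serves all the equations. *)
have {}sol : {ae leb, forall x, forall m, Omega x ->
    c x * (\sum_(n < N) s_coef T Psi m n * v n x) =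
    laplacian (v m) x + q_coef T Psi q m (fun n => v n x)}.
  exact: filter_forall.
apply: filterS2 sol vM => x sol vM Ox; rewrite -EFinM lee_fin.
set P := fun n => cutoff T M (y n x).
have Pv : (fun n => v n x) = (fun n => cutoff T M (v n x)).
  by apply/funext => n; rewrite cutoff_id// vM.
pose D := \sum_(n < N) (y n x - v n x) ^+ 2.
have D0 : 0 <= D by apply: sumr_ge0 => n _; exact: sqr_ge0.
have -> : wsq lambda (fun m x => y m x - v m x) x = w lambda x ^+ 2 * D.
  by rewrite mulr_sumr; apply: eq_bigr => n _; rewrite exprMn.
have rm m : (w lambda x * res (fun m x => q_coef T Psi q m (fun n => cutoff T M (y n x))) v m x) ^+ 2
    <= w lambda x ^+ 2 * (L ^+ 2 * (N%:R * D)).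
  rewrite exprMn ler_wpM2l ?sqr_ge0//.
  rewrite /residual (sol m Ox) opprD addrA subrr add0r addrC Pv.
  rewrite -(real_normK (num_real (_ - _))).
  have h := q_coef_lipschitz _ _ _ _ T0 cPsi q M m P (fun n => cutoff T M (v n x)) Cq M0
    (fun n => cutoff_le _ _ _ _ M0) (fun n => cutoff_le _ _ _ _ M0).
  have hS : \sum_(n < N) `|P n - cutoff T M (v n x)| <= \sum_(n < N) `|y n x - v n x|.
    by apply: ler_sum => n _; exact: cutoff_lipschitz.
  have S0 : 0 <= \sum_(n < N) `|P n - cutoff T M (v n x)| by exact: sumr_ge0.
  apply: (@le_trans _ _ ((L * \sum_(n < N) `|P n - cutoff T M (v n x)|) ^+ 2)).
    by rewrite ler_sqr ?nnegrE// (le_trans _ h).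
  rewrite exprMn ler_wpM2l ?sqr_ge0//.
  apply: (@le_trans _ _ ((\sum_(n < N) `|y n x - v n x|) ^+ 2)).
    by rewrite ler_sqr ?nnegrE// sumr_ge0.
  apply: le_trans (sqr_sum_le _ _ _ _) _.
  rewrite [size _](_ : _ = N); last by rewrite -[RHS]card_ord cardT enumT.
  rewrite ler_wpM2l// le_eqVlt; apply/orP; left; apply/eqP.
  by apply: eq_bigr => n _; rewrite real_normK// num_real.
apply: (@le_trans _ _ (\sum_(m < N) w lambda x ^+ 2 * (L ^+ 2 * (N%:R * D)))).
  exact: ler_sum.
rewrite sumr_const card_ord -mulr_natl le_eqVlt; apply/orP; left; apply/eqP; ring.
Qed.

(** Here [y] stands for the previous iterate. The lower bound on [C' * lambda ^ 3] is the absorption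
    condition [2 K <= l] of [ereal_absorb], with [K] the zero-order coefficient of
    [residual_coercive]. *)
Lemma contraction_step (C' B lambda : R) f g (q : R -> R) (M : R)
    (u v : 'I_N -> H2 Omega) (y : 'I_N -> 'rV[R]_d -> R) :
  0 < C' -> 0 < lambda -> (forall x, Omega x -> `|c x| <= B) ->
  4 * (B ^+ 2 * N%:R * s_norm2) <= C' * lambda ^+ 3 ->
  (forall z : H2 Omega, has_trace z (fun=> 0) -> has_normal_trace z (fun=> 0) ->
    ((C' * lambda ^+ 3)%:E * \int[leb]_(x in Omega) ((w lambda x * z x) ^+ 2)%:E <=
     \int[leb]_(x in Omega) ((w lambda x * laplacian z x) ^+ 2)%:E)%E) ->
  0 <= M -> C1_fun q -> (forall m, measurable_fun Omega (y m)) ->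
  is_minimizer (admissible f g) (J T Psi c x0 b beta lambda
    (fun m x => q_coef T Psi q m (fun n => cutoff T M (y n x)))) u ->
  admissible f g v -> solves T Psi c q v ->
  {ae leb, forall x, Omega x -> forall m, `|v m x| <= M * Num.sqrt T} ->
  (\int[leb]_(x in Omega) (wsq lambda (fun m x => u m x - v m x)%R x)%:E <=
   (8 * (N%:R * (C1norm (q_radius N T Psi M) q * Psi_sup R T Psi N ^+ 2 * T)) ^+ 2
     / (C' * lambda ^+ 3))%:E *
   \int[leb]_(x in Omega) (wsq lambda (fun m x => y m x - v m x)%R x)%:E)%E.
Proof.
move=> C0 l0 cB hl carl M0 Cq my minu Av sol vM.
have [Au _] := minu.
pose h := H2_diff R d N Omega mO bO u v.
have hE m x : h m x = u m x - v m x by rewrite /h /H2_diff /=; ring.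
have mF m : measurable_fun Omega (fun x => q_coef T Psi q m (fun n => cutoff T M (y n x))).
  exact: measurable_q_coef_cutoff.
have min_le := minimizer_residual_le _ _ _ _ _ _ _ _ _ _ mO bO cc _ _ _ _ _ _ mF minu Av.
have dat := data_error_le lambda _ _ _ _ M0 Cq my sol vM.
have -> : (\int[leb]_(x in Omega) (wsq lambda (fun m x => u m x - v m x)%R x)%:E =
    \int[leb]_(x in Omega) (wsq lambda (fun m => h m) x)%:E)%E.
  apply: eq_integral => x _; congr EFin; rewrite /weighted_sqr.
  by apply: eq_bigr => m _; rewrite hE.
have mh m : measurable_fun Omega (h m) by exact: measurable_H2.
have El : (\int[leb]_(x in Omega) (wsq lambda (fun m => h m) x)%:E < +oo)%E.
  by apply: weighted_sqr_lty => [|m]; [exact: ltW|exact: H2val_L2].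
(* [u] and [v] share their boundary data, so their difference has zero traces, as the Carleman
   estimate demands. *)
have zero (k : 'rV[R]_d -> R) : (fun x => 1 * k x + -1 * k x) = fun=> 0.
  by apply/funext => x; ring.
have main : ((C' * lambda ^+ 3)%:E * \int[leb]_(x in Omega) (wsq lambda (fun m => h m) x)%:E <=
    2%:E * \int[leb]_(x in Omega) (wsq lambda (res (fun _ _ => 0) h) x)%:E +
    (2 * (B ^+ 2 * N%:R * s_norm2))%:E * \int[leb]_(x in Omega) (wsq lambda (fun m => h m) x)%:E)%E.
  have s0 : 0 <= B ^+ 2 * N%:R * s_norm2.
    apply: mulr_ge0; first by apply: mulr_ge0 => //; exact: sqr_ge0.
    apply: sumr_ge0 => m _; apply: sumr_ge0 => n _; exact: sqr_ge0.
  have mr m : measurable_fun Omega (res (fun _ _ => 0) h m) by exact: measurable_residual.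
  apply: (@le_trans _ _ (\int[leb]_(x in Omega)
      (\sum_(m < N) (w lambda x * laplacian (h m) x) ^+ 2)%:E)%E).
    rewrite -(sum_integral_weighted _ _ _ _ _ _ _ mO _ (fun m => laplacian (h m))); last first.
      by move=> m; exact: measurable_laplacian.
    rewrite -sum_integral_weighted// ge0_sume_distrr; last first.
      by move=> m _; apply: integral_ge0 => x _; rewrite lee_fin sqr_ge0.
    apply: lee_sum => m _; apply: carl.
      by rewrite -(zero (f m)); apply: has_trace_linear; [case: (Au m)|case: (Av m)].
    by rewrite -(zero (g m)); apply: has_normal_trace_linear; [case: (Au m)|case: (Av m)].
  rewrite -!ge0_integralZl//; try (by move=> x _; rewrite lee_fin weighted_sqr_ge0);
    try (by apply/measurable_EFinP; exact: measurable_weighted_sqr);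
    try (by rewrite lee_fin mulr_ge0).
  rewrite -ge0_integralD//;
    try (by move=> x _; rewrite -EFinM lee_fin mulr_ge0 ?weighted_sqr_ge0// mulr_ge0);
    try (by apply/measurable_EFinP; apply: measurable_funM => //; exact: measurable_weighted_sqr).
  apply: ge0_le_integral => //.
  - by move=> x _; rewrite lee_fin sumr_ge0// => m _; exact: sqr_ge0.
  - apply/measurable_EFinP; apply: (measurable_weighted_sqr _ _ _ _ _ _ _ _ (fun m => laplacian (h m))) => m.
    exact: measurable_laplacian.
  - by apply/measurable_EFinP; apply: measurable_funD; apply: measurable_funM => //; exact: measurable_weighted_sqr.
  - by move=> x Ox; rewrite -!EFinM -EFinD lee_fin; apply: residual_coercive; exact: cB.
have E0 : (0 <= \int[leb]_(x in Omega) (wsq lambda (fun m => h m) x)%:E)%E.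
  by apply: integral_ge0 => x _; rewrite lee_fin weighted_sqr_ge0.
have Y0 : (0 <= \int[leb]_(x in Omega) (wsq lambda (fun m x => y m x - v m x)%R x)%:E)%E.
  by apply: integral_ge0 => x _; rewrite lee_fin weighted_sqr_ge0.
have R0 : (0 <= \int[leb]_(x in Omega) (wsq lambda (res (fun _ _ => 0%R) h) x)%:E)%E.
  by apply: integral_ge0 => x _; rewrite lee_fin weighted_sqr_ge0.
move: dat min_le main E0 El Y0 R0; rewrite -/h.
set L := (N%:R * _).
move: (\int[leb]_(x in Omega) (wsq lambda (fun m => h m) x)%:E)%E => E.
move: (\int[leb]_(x in Omega) (wsq lambda (res (fun _ _ => 0%R) h) x)%:E)%E => A.
move: (\int[leb]_(x in Omega) _)%E => D.
move: (\int[leb]_(x in Omega) _)%E => Y.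
move=> hD hA hE' E0 El Y0 A0; apply: (ereal_absorb _ _ _ _ _ _ _ _ hD _ _ _ hA hE' E0 El Y0 A0) => //.
- by rewrite mulr_gt0// exprn_gt0.
- exact: sqr_ge0.
- by apply: le_trans hl; rewrite le_eqVlt; apply/orP; left; apply/eqP; ring.
Qed.


End step.

(** * The theorem *)

(** The hypothesis bounds squares, so the rate is [sqrt th]. It starts at index 1: the summand [l 0]
    covers index 0, and the division by [rho] makes up for the shift. *)
Lemma geometric_bound (R : realType) (l : nat -> \bar R) (e th : R) :
  0 < th < 1 -> 0 <= e -> (forall k, 0 <= l k)%E -> (forall k, l k < +oo)%E ->
  (forall k, l k.+1 ^+ 2 <= (th ^+ k * e)%:E)%E ->
  exists A rho : R, [/\ 0 < A, 0 < rho < 1 & forall k, (l k <= (A * rho ^+ k)%:E)%E].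
Proof.
move=> /andP[th0 th1] e0 l0 loo le.
pose rho := Num.sqrt th.
have rho0 : 0 < rho by rewrite sqrtr_gt0.
have rho2 : rho ^+ 2 = th by rewrite sqr_sqrtr// ltW.
have rho1 : rho < 1 by rewrite -sqrtr1 ltr_sqrt.
have fl k : (l k = (fine (l k))%:E)%E by rewrite fineK// ge0_fin_numE.
have fl0 k : 0 <= fine (l k) by exact: fine_ge0.
have se0 : 0 <= Num.sqrt e by exact: sqrtr_ge0.
exists (fine (l 0%N) + (Num.sqrt e + 1) / rho), rho; split.
- by rewrite ltr_wpDl// divr_gt0// ltr_wpDl.
- by rewrite rho0.
case=> [|k].
  by rewrite expr0 mulr1 fl lee_fin lerDl divr_ge0 ?addr_ge0// ltW.
rewrite fl lee_fin.
apply: (@le_trans _ _ (rho ^+ k * Num.sqrt e)).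
  rewrite -ler_sqr ?nnegrE ?mulr_ge0 ?exprn_ge0 ?(ltW rho0)//.
  rewrite exprMn -exprM mulnC exprM rho2 sqr_sqrtr//.
  by rewrite -lee_fin EFin_expe -fl; exact: le.
rewrite exprS mulrA [leLHS]mulrC ler_wpM2r ?exprn_ge0 ?(ltW rho0)//.
rewrite mulrDl; apply: (@le_trans _ _ ((Num.sqrt e + 1) / rho * rho)).
  by rewrite divfK ?gt_eqF// lerDl.
by rewrite lerDr mulr_ge0// ltW.
Qed.

Lemma cvg_L2_sum d (X : measurableType d) (R : realType)
    (mu : {measure set X -> \bar R}) (D : set X) N (a : 'I_N -> R)
    (f : nat -> 'I_N -> X -> R) (g : 'I_N -> X -> R) :
  (forall n, cvg_L2 mu D (fun k => f k n) (g n)) ->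
  cvg_L2 mu D (fun k x => \sum_(n < N) f k n x * a n) (fun x => \sum_(n < N) g n x * a n).
Proof.
move=> fg; elim: (index_enum _) => [|n r IH].
  under eq_fun do under eq_fun do rewrite big_nil.
  under [X in cvg_L2 _ _ _ X]eq_fun do rewrite big_nil.
  have z0 : (fun=> 0 : R) \_ D = 0 :> (X -> R).
    by apply/funext => x; rewrite /patch; case: ifP.
  have z : inL2 mu D (fun=> 0).
    by rewrite /inL2 z0; have [] := Lfun_submod_closed mu (lee1n 2 : (1 <= 2%:E)%E).
  split => //; rewrite (_ : (fun _ => _) = cst 0%E); first exact: cvg_cst.
  apply/funext => k; rewrite /L2norm (_ : (_ \- _) = fun=> 0).
    by rewrite z0; apply: Lnorm0; rewrite eqe pnatr_eq0.
  by apply/funext => x /=; rewrite subrr.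
have := cvg_L2_linear _ _ _ _ D (a n) 1 _ _ _ _ (fg n) IH.
set f1 := (X in cvg_L2 _ _ X _); set g1 := (X in cvg_L2 _ _ _ X).
rewrite (_ : f1 = fun k x => \sum_(m <- n :: r) f k m x * a m); last first.
  by apply/funext => k; apply/funext => x; rewrite /f1 big_cons mul1r mulrC.
rewrite (_ : g1 = fun x => \sum_(m <- n :: r) g m x * a m)//.
by apply/funext => x; rewrite /g1 big_cons mul1r mulrC.
Qed.

Theorem theorem4p1 (R : realType) (d N : nat) (T : R) (Omega : set 'rV[R]_d)
    (c : 'rV[R]_d -> R) (c0 : R) (Psi : nat -> R -> R)
    (x0 : 'rV[R]_d) (b beta : R)
    (hd : (1 <= d)%N) (hN : (1 <= N)%N) (hT : 0 < T)
    (hOmega : smooth_bounded_domain Omega)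
    (hc : Ck 1 c) (hc0 : 0 < c0) (hcc0 : forall x, c0 <= c x)
    (hPsi : orthonormal_basis T Psi)
    (hPsiC1 : forall n, C1_segment 0 T (Psi n))
    (hx0 : ~ Omega x0)
    (hr : forall x, closure Omega x -> 1 < rdist x0 x)
    (hb : forall x, closure Omega x -> rdist x0 x < b)
    (hbeta : 0 < beta)
    (hcarleman : carleman_estimate Omega x0 b beta) :
  exists lambda0 : R, 0 < lambda0 /\
  forall M : R, 0 < M ->
  forall normq : R,
  exists C : R, 0 < C /\
  forall (q : R -> R) (f g : 'I_N -> 'rV[R]_d -> R)
    (ustar : 'I_N -> H2 Omega),
  C1_fun q ->
  C1norm (q_radius N T Psi M) q = normq ->
  (forall m, L2_boundary Omega (f m)) ->
  (forall m, L2_boundary Omega (g m)) ->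
  admissible f g ustar ->
  solves T Psi c q ustar ->
  (forall v : 'I_N -> H2 Omega,
    admissible f g v -> solves T Psi c q v ->
    forall m, {ae lebesgue_rV R d, forall x, Omega x -> v m x = ustar m x}) ->
  (Linfty_norm T Omega (expansion Psi (fun n x => ustar n x)) < M%:E)%E ->
  forall (lambda : R) (u : nat -> 'I_N -> H2 Omega),
  lambda0 <= lambda ->
  iterates T Psi c q x0 b beta M lambda f g u ->
  (forall k, (1 <= k)%N ->
    (\sum_(m < N) L2norm (lebesgue_rV R d) Omega
        (fun x => weight x0 b beta lambda x * (u k m x - ustar m x))%R ^+ 2
     <= ((C / lambda ^+ 3) ^+ k.-1)%:E *
        \sum_(m < N) L2norm (lebesgue_rV R d) Omega
          (fun x => weight x0 b beta lambda x * (u 1%N m x - ustar m x))%R ^+ 2)%E)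
  /\
  (0 < C / lambda ^+ 3 < 1 ->
    (forall m, exists A rho : R, [/\ 0 < A, 0 < rho < 1 &
      forall k, (L2norm (lebesgue_rV R d) Omega (fun x => u k m x - ustar m x)%R
                 <= (A * rho ^+ k)%:E)%E])
    /\
    cvg_L2 (lebesgue_rV R d) Omega
      (fun k x => expansion Psi (fun n y => u k n y) x 0)
      (fun x => expansion Psi (fun n y => ustar n y) x 0)).
Proof.
have [oO _ _ bO _] := hOmega.
have mO := open_measurable_rV _ _ _ oO.
have [cc _ _] := hc.
have [B B0 cB] := continuous_bounded_on _ _ _ _ bO cc.
have [C' [lambda' [C'0 lambda'0 carl]]] := hcarleman.
pose K := 4 * (B ^+ 2 * N%:R * s_norm2 R N T Psi).
(* [lambda'] makes the Carleman estimate available; [lambda >= 1] gives [lambda ^ 3 >= lambda], so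
   that [lambda >= K / C'] ensures [K <= C' * lambda ^ 3]. *)
exists (Num.max (Num.max lambda' 1) (K / C')); split.
  by rewrite !lt_max ltr01 orbT.
move=> M M0 normq.
(* [C] must be fixed before [q], so [normq] replaces the norm of [q]; the square and the final [+ 1]
   make [C] positive for every real [normq]. *)
pose Lq := N%:R * (normq * Psi_sup R T Psi N ^+ 2 * T).
have hL : 0 < 8 * Lq ^+ 2 / C' + 1.
  rewrite ltr_wpDl// divr_ge0 ?(ltW C'0)//.
  by apply: mulr_ge0 => //; exact: sqr_ge0.
exists (8 * Lq ^+ 2 / C' + 1); split => //.
move=> q f g v Cq Cqn _ _ Av sol _ vM lambda u.
rewrite !ge_max -andbA => /and3P[ll' l1 lK] [_ min_u].
have l0 : 0 < lambda by exact: lt_le_trans l1.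
have l30 : 0 < lambda ^+ 3 by rewrite exprn_gt0.
have lK3 : K <= C' * lambda ^+ 3.
  apply: (@le_trans _ _ (C' * lambda)); first by rewrite mulrC -ler_pdivrMr.
  rewrite ler_wpM2l ?(ltW C'0)// exprS -[leLHS]mulr1 ler_wpM2l ?(ltW l0)//.
  by rewrite exprn_ege1.
set th := _ / lambda ^+ 3.
have th0 : 0 < th by rewrite divr_gt0.
have vM' := Linfty_coefficient_le _ _ _ _ _ hT hPsi hPsiC1 Omega M _ (ltW M0) vM.
have hb' x : Omega x -> rdist x0 x <= b.
  by move=> Ox; apply/ltW/hb/subset_closure.
pose E k := (\int[lebesgue_rV R d]_(x in Omega)
  (weighted_sqr R d N x0 b beta lambda (fun m x => u k m x - v m x)%R x)%:E)%E.
have E0 k : (0 <= E k)%E.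
  by apply: integral_ge0 => x _; rewrite lee_fin weighted_sqr_ge0.
have hdiff k m : inL2 (lebesgue_rV R d) Omega (fun x => u k m x - v m x).
  rewrite (_ : (fun _ => _) = fun x => 1 * u k m x + -1 * v m x).
    by apply: inL2_linear; exact: H2val_L2.
  by apply/funext => x; ring.
have mdiff k m := inL2_measurable_in _ _ _ _ _ _ mO (hdiff k m).
have EE k : (\sum_(m < N) L2norm (lebesgue_rV R d) Omega
    (fun x => weight x0 b beta lambda x * (u k m x - v m x))%R ^+ 2 = E k)%E.
  rewrite /E -sum_integral_weighted//; apply: eq_bigr => m _.
  rewrite L2norm_sqr//; apply: measurable_funM; last exact: mdiff.
  exact: measurable_weight_in.
have Eoo k : (E k < +oo)%E by apply: weighted_sqr_lty => //; exact: ltW.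
have step k : (E k.+1 <= th%:E * E k)%E.
  apply: le_trans (contraction_step _ _ _ _ _ _ _ _ _ _ mO bO cc hT hPsiC1 hb' (ltW hbeta)
    C' B lambda f g q M (u k.+1) v (fun m x => u k m x) C'0 l0 cB lK3 _ (ltW M0) Cq _ (min_u k) Av sol vM') _.
  - by move=> z tz nz; apply: carleman_L2 => //; exact: carl.
  - by move=> m; exact: measurable_H2.
  - apply: lee_wpmul2r; first exact: E0.
    rewrite lee_fin Cqn -/Lq /th.
    rewrite invfM mulrA ler_wpM2r ?invr_ge0 ?(ltW l30)//.
    by rewrite lerDl.
clearbody th.
(* The exponent counts the steps after index 1, which yields the power [k - 1] for the iterate
   [k]. *)
have geo k : (E k.+1 <= (th ^+ k)%:E * E 1%N)%E.
  elim: k => [|k IH]; first by rewrite expr0 mul1e.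
  apply: le_trans (step _) _; rewrite exprS EFinM -muleA.
  by apply: lee_wpmul2l => //; rewrite lee_fin ltW.
split=> [[//|k] _|/andP[_ th1]]; first by rewrite !EE; exact: geo.
have rate m : exists A rho : R, [/\ 0 < A, 0 < rho < 1 &
    forall k, (L2norm (lebesgue_rV R d) Omega (fun x => u k m x - v m x)%R
               <= (A * rho ^+ k)%:E)%E].
  apply: (geometric_bound _ _ (fine (E 1%N)) th).
  - by rewrite th0.
  - exact: fine_ge0.
  - by move=> k; exact: Lnorm_ge0.
  - by move=> k; exact: inL2_L2norm_lty.
  (* The weight is at least 1, so the plain norm of one component is below its weighted norm, itself
     one term of the sum [E]. *)
  - move=> k; rewrite EFinM fineK ?ge0_fin_numE//.
    apply: le_trans (geo k); rewrite -EE L2norm_sqr//.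
    rewrite (bigD1 m)// L2norm_sqr//; last first.
      by apply: measurable_funM; [exact: measurable_weight_in|exact: mdiff].
    apply: (@le_trans _ _ (\int[lebesgue_rV R d]_(x in Omega)
      ((weight x0 b beta lambda x * (u k.+1 m x - v m x)) ^+ 2)%:E)%E).
      apply: ge0_le_integral => //.
      + by move=> x _; rewrite lee_fin sqr_ge0.
      + by apply/measurable_EFinP; apply: measurable_funX; exact: mdiff.
      + apply/measurable_EFinP; apply: measurable_funX.
        by apply: measurable_funM; [exact: measurable_weight_in|exact: mdiff].
      + move=> x _; rewrite lee_fin exprMn ler_peMl ?sqr_ge0//.
        by rewrite exprn_ege1// weight_ge1// ltW.
    by rewrite leeDl// sume_ge0// => n _; rewrite expe2 mule_ge0// Lnorm_ge0.
split=> //.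
(* At [t = 0] the expansion is a finite combination with the constant coefficients [Psi n 0], so
   componentwise convergence suffices. *)
apply: cvg_L2_sum => m; split.
- by move=> k; exact: H2val_L2.
- exact: H2val_L2.
have [A [rho [A0 /andP[rho0 rho1] hA]]] := rate m.
apply: (@squeeze_cvge _ _ _ _ (cst 0%E) _ (fun k => (A * rho ^+ k)%:E)).
- by apply: nearW => k; rewrite Lnorm_ge0/=; exact: hA.
- exact: cvg_cst.
- apply: cvg_EFin; first exact: nearW.
  by apply: cvg_geometric; rewrite gtr0_norm.
Qed.
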